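(* Let $\Gamma$ be a connected amply regular graph with diameter $d\ge 4$ and parameters $(v,k,\lambda,\mu)$, where $\mu=\frac{k-1}{2}$ and $k\ge5$ is odd. Then one of the following holds: (1) $\Gamma$ is the $5$-cube; (2) $\Gamma$ is the graph $\mathrm{K}_2\,\square\,\Delta_{4.1}$, which has diameter $4$ and parameters $(28,5,0,2)$; (3) $\Gamma$ is the relation graph of a relation $R$ of a symmetric association scheme $(X,\mathcal R)$ with $5$ classes, such that for every vertex $x$ the six classes $\{y:(x,y)\in R_j\}$ form an equitable partition $D_0=\{x\}$, $D_1=\Gamma(x)$, $D_2$, $D_3$, $D_3'$, $D_4$ of sizes $1,k,2k,k,2,1$ with quotient numbers (number of neighbours of a vertex of the first cell in the second cell, all others $0$): $D_0\to D_1: k$; $D_1\to D_0: 1$, $D_1\to D_2: k-1$; $D_2\to D_1: \frac{k-1}{2}$, $D_2\to D_3: \frac{k-1}{2}$, $D_2\to D_3': 1$; $D_3\to D_2: k-1$, $D_3\to D_4: 1$; $D_3'\to D_2: k$; $D_4\to D_3: k$. In particular, in case (3) $\Gamma$ is a bipartite, $2$-walk-regular graph of order $4k+4$, with diameter $4$ and exactly $6$ distinct eigenvalues.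
   Context: All graphs are finite, simple, undirected. An amply regular graph with parameters $(v,k,\lambda,\mu)$ is a $k$-regular graph on $v$ vertices in which any two adjacent vertices have exactly $\lambda$ common neighbours and any two vertices at distance $2$ have exactly $\mu$ common neighbours. $\square$ denotes the Cartesian product, $\mathrm{K}_2$ a single edge, and $\Delta_{4.1}$ the point-block incidence graph of the (unique) square $2$-$(7,4,2)$ design (a biplane on $14$ vertices of valency $4$). A symmetric association scheme with $n$ classes on a finite set $X$ is a partition $\mathcal R=\{R_0,\dots,R_n\}$ of $X\times X$ with symmetric $0/1$ adjacency matrices $F_i$ such that $F_0=I$, $\sum F_i=J$, and each $F_iF_j$ is a linear combination of $F_0,\dots,F_n$; the relation graph of $R_i$ is the graph $(X,R_i)$. A graph is $t$-walk-regular if the number of walks of each length between two vertices depends only on their distance whenever it is at most $t$. The distance partition cells: $D_1=\Gamma(x)$, $D_2=\Gamma_2(x)$, $D_3\cup D_3'=\Gamma_3(x)$, $D_4=\Gamma_4(x)$. In the paper, the equitable partition in (3) is given by a figure; it is written out here explicitly. *)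

(* Defs.v *)
From HB Require Import structures.
From mathcomp Require Import all_boot all_order all_algebra all_field.
Set Implicit Arguments. Unset Strict Implicit. Unset Printing Implicit Defensive.
Import Order.TTheory GRing.Theory Num.Theory.

Definition simple_graph (T : finType) (e : rel T) :=
  symmetric e /\ irreflexive e.

Fixpoint dist_le (T : finType) (e : rel T) (n : nat) (x y : T) : bool :=
  match n with
  | 0 => x == y
  | n'.+1 => dist_le e n' x y || [exists z, dist_le e n' x z && e z y]
  end.

Definition at_dist (T : finType) (e : rel T) (n : nat) (x y : T) : bool :=
  dist_le e n x y && ((n == 0) || ~~ dist_le e n.-1 x y).

Definition connected_graph (T : finType) (e : rel T) :=
  forall x y : T, connect e x y.

Definition diameter (T : finType) (e : rel T) (d : nat) :=
  (exists x y, at_dist e d x y) /\ (forall x y n, at_dist e n x y -> n <= d).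

Definition common_nbrs (T : finType) (e : rel T) (x y : T) : {set T} :=
  [set z | e x z && e y z].

Definition amply_regular (T : finType) (e : rel T) (v k lam mu : nat) :=
  [/\ #|T| = v,
      forall x, #|[set y | e x y]| = k,
      forall x y, e x y -> #|common_nbrs e x y| = lam &
      forall x y, at_dist e 2 x y -> #|common_nbrs e x y| = mu].

Definition graph_iso (T1 T2 : finType) (e1 : rel T1) (e2 : rel T2) :=
  exists f : T1 -> T2, bijective f /\ forall x y, e2 (f x) (f y) = e1 x y.

Definition cube5 : rel {ffun 'I_5 -> bool} :=
  fun f g => #|[set i | f i != g i]| == 1.

(* Delta_{4.1}: point-block incidence graph of the square 2-(7,4,2) design,
   realised as the complement of the cyclic Fano plane: points i in Z/7,
   blocks b in Z/7, point p lies in block b iff p - b mod 7 is in {2,4,5,6}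
   (block b is the complement of the Fano line {b, b+1, b+3}). *)
Definition biplane_inc (p b : 'I_7) : bool := ((p + 7 - b) %% 7) \in [:: 2; 4; 5; 6].

Definition delta41 : rel ('I_7 + 'I_7)%type :=
  fun u w => match u, w with
             | inl p, inr b => biplane_inc p b
             | inr b, inl p => biplane_inc p b
             | _, _ => false
             end.

Definition K2_box (T : finType) (e : rel T) : rel (bool * T)%type :=
  fun u w => ((u.1 == w.1) && e u.2 w.2) || ((u.1 != w.1) && (u.2 == w.2)).

(* Symmetric association scheme with n classes on T, given by relations
   R 0 .. R n with 0/1 adjacency matrices F_i x y = (R i x y)%:R.
   F_0 = I, sum_i F_i = J, F_i symmetric, and F_i F_j is a linear combination
   of F_0..F_n (matrix product written entrywise over T). *)
Definition assoc_scheme (T : finType) (n : nat) (R : 'I_n.+1 -> rel T) :=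
  [/\ forall x y, R ord0 x y = (x == y),
      forall x y, (\sum_(i < n.+1) R i x y)%N = 1%N,
      forall i x y, R i x y = R i y x &
      forall i j : 'I_n.+1, exists p : 'I_n.+1 -> rat, forall x y : T,
        (\sum_(z : T) (R i x z)%:R * (R j z y)%:R
          = \sum_(h < n.+1) p h * (R h x y)%:R)%R].

Definition cell_size (k : nat) (i : 'I_6) : nat :=
  match val i with
  | 0 => 1 | 1 => k | 2 => 2 * k | 3 => k | 4 => 2 | _ => 1
  end.

(* quotient matrix: q i j = number of neighbours in cell j of a vertex of cell i;
   cells indexed 0:D0, 1:D1, 2:D2, 3:D3, 4:D3', 5:D4 *)
Definition quot_mat (k : nat) (i j : 'I_6) : nat :=
  match val i, val j with
  | 0, 1 => k
  | 1, 0 => 1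
  | 1, 2 => k.-1
  | 2, 1 => k.-1./2
  | 2, 3 => k.-1./2
  | 2, 4 => 1
  | 3, 2 => k.-1
  | 3, 5 => 1
  | 4, 2 => k
  | 5, 3 => k
  | _, _ => 0
  end.

Definition bipartite (T : finType) (e : rel T) :=
  exists c : T -> bool, forall x y, e x y -> c x != c y.

Fixpoint walks (T : finType) (e : rel T) (n : nat) (x y : T) : nat :=
  match n with
  | 0 => (x == y : nat)
  | n'.+1 => (\sum_(z : T) walks e n' x z * e z y)%N
  end.

Definition walk_regular (T : finType) (e : rel T) (t : nat) :=
  forall m n x y x' y', m <= t -> at_dist e m x y -> at_dist e m x' y' ->
    walks e n x y = walks e n x' y'.

Definition adjmx (T : finType) (e : rel T) : 'M[algC]_#|T| :=
  \matrix_(i, j) ((e (enum_val i) (enum_val j))%:R)%R.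

Definition num_eigenvalues (T : finType) (e : rel T) (m : nat) :=
  exists s : seq algC, [/\ uniq s, size s = m &
    forall a, eigenvalue (adjmx e) a <-> a \in s].

(* Main.v *)
(** Vertices x, y at distance 4 split the neighbourhood of a middle
    vertex z into mu common neighbours with x, mu with y, and one more.  This
    forces lam = 0 and, when mu >= 3, that every neighbour of x on the way to y
    has all its other neighbours at distance 2 from y.  Under the latter
    condition double counting determines the graph around x completely: it is
    bipartite with halves of size 2k + 2 and every vertex has one antipode.
    The case mu = 2, k = 5 is settled by an exhaustive search that closes one
    4-cycle at a time, starting from a star; the graphs violating the condition
    are the 5-cube and the product of K_2 with Delta_4.1.  The scheme and the eigenvalues are
    read off the 6 x 6 quotient matrix. *)

Require Import Defs.
From HB Require Import structures.
From mathcomp Require Import all_boot all_order all_algebra all_field.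
From mathcomp Require Import zify ring.

Set Implicit Arguments.
Unset Strict Implicit.
Unset Printing Implicit Defensive.

(** * Distances *)

(** The hypotheses are local counts, so global structure has to be propagated. Before
    [geodesic_closed] is known, the tool is a count of edges between two small sets attached to a
    neighbour [a] of [x]. It is played against the bound that more than [mu] neighbours of [a] lead
    on towards [y]. The last of these counts carries a factor [mu - 2], which vanishes for [mu = 2];
    hence the search in valency 5. Once [geodesic_closed] holds, counting the 4-cycles through one
    edge ([rect_full]) spreads a property from one neighbour of a vertex to all of them.

    The level at distance 3 splits into two classes that distance does not separate, so the symmetry
    of the relations is itself something to prove. Moreover, equitable partitions around all
    vertices only control products with the adjacency matrix. All products of classes stay in the
    span because every class matrix turns out to be a polynomial in the adjacency matrix. *)

Section Distance.
Variables (T : finType) (e : rel T).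
Hypotheses (eS : symmetric e) (eI : irreflexive e).
Implicit Types x y z : T.

Lemma dist_le0 x : dist_le e 0 x x.
Proof. by rewrite /= eqxx. Qed.

Lemma dist_leS n x y : dist_le e n x y -> dist_le e n.+1 x y.
Proof. by move=> h /=; rewrite h. Qed.

Lemma dist_le_leq m n x y : m <= n -> dist_le e m x y -> dist_le e n x y.
Proof.
move=> /subnK <-; elim: (n - m) => [//|k IHk] h.
by rewrite addSn; apply/dist_leS/IHk.
Qed.

Lemma dist_le_refl n x : dist_le e n x x.
Proof. exact: dist_le_leq (leq0n n) (dist_le0 x). Qed.

Lemma dist_le_snoc n x y z : dist_le e n x y -> e y z -> dist_le e n.+1 x z.
Proof. by move=> h1 h2; apply/orP; right; apply/existsP; exists y; apply/andP. Qed.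

Lemma dist_le_last n x z : dist_le e n.+1 x z ->
  dist_le e n x z \/ exists2 y, dist_le e n x y & e y z.
Proof.
case/orP=> [h|/existsP[y /andP[h1 h2]]]; first by left.
by right; exists y.
Qed.

Lemma dist_le_cons n x y z : e x y -> dist_le e n y z -> dist_le e n.+1 x z.
Proof.
elim: n z => [|n IHn] z h.
  by move=> /= /eqP <-; apply: (@dist_le_snoc 0 x x); rewrite ?dist_le0.
case/dist_le_last=> [h1|[w h1 h2]]; first exact/dist_leS/IHn.
exact: dist_le_snoc (IHn _ h h1) h2.
Qed.

Lemma dist_le_sym n x y : dist_le e n x y -> dist_le e n y x.
Proof.
elim: n y => [|n IHn] y; first by rewrite /= eq_sym.
case/dist_le_last=> [h1|[w h1 h2]]; first exact/dist_leS/IHn.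
by apply: dist_le_cons (IHn _ h1); rewrite eS.
Qed.

Lemma dist_le1 x y : dist_le e 1 x y = (x == y) || e x y.
Proof.
rewrite /=; congr (_ || _); apply/existsP/idP => [[z /andP[/eqP <-]]//|h].
by exists x; rewrite eqxx.
Qed.

Lemma dist_le_edge x y : e x y -> dist_le e 1 x y.
Proof. by rewrite dist_le1 => ->; rewrite orbT. Qed.

Lemma dist_le_trans m n x y z :
  dist_le e m x y -> dist_le e n y z -> dist_le e (m + n) x z.
Proof.
move=> h; elim: n z => [|n IHn] z; first by rewrite addn0 /= => /eqP <-.
rewrite addnS; case/dist_le_last=> [h1|[w h1 h2]]; first exact/dist_leS/IHn.
exact: dist_le_snoc (IHn _ h1) h2.
Qed.

Lemma dist_le_first n x z : dist_le e n.+1 x z ->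
  dist_le e n x z \/ exists2 y, e x y & dist_le e n y z.
Proof.
move/dist_le_sym/dist_le_last=> [/dist_le_sym|[y /dist_le_sym h1 h2]]; first by left.
by right; exists y; rewrite // eS.
Qed.

Lemma at_distS n x y : at_dist e n.+1 x y = dist_le e n.+1 x y && ~~ dist_le e n x y.
Proof. by []. Qed.

Lemma at_dist_sym n x y : at_dist e n x y -> at_dist e n y x.
Proof.
case/andP=> h1 h2; rewrite /at_dist (dist_le_sym h1) /=.
by case: eqP h2 => //= _; apply: contra; exact: dist_le_sym.
Qed.

Lemma at_dist_prev n x y : at_dist e n.+1 x y -> exists2 z, at_dist e n x z & e z y.
Proof.
rewrite at_distS => /andP[/dist_le_last[->//|[z h1 h2]] h3].
exists z; rewrite // /at_dist h1 /=; case: n h1 h3 => //= n h1 h3.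
by apply: contra h3 => h; exact: (dist_le_snoc h h2).
Qed.

Lemma at_dist_mid m n x y : at_dist e (m + n) x y ->
  exists2 z, at_dist e m x z & dist_le e n z y.
Proof.
elim: n y => [|n IHn] y; first by rewrite addn0 => h; exists y; rewrite ?dist_le_refl.
rewrite addnS => /at_dist_prev[z /IHn[w h1 h2] h3].
by exists w => //; exact: dist_le_snoc h2 h3.
Qed.

Lemma at_dist1 x y : at_dist e 1 x y = e x y.
Proof.
rewrite at_distS dist_le1 /=; case: eqP => [->|] //=; last by rewrite andbT.
Qed.

Lemma at_dist2 x y : at_dist e 2 x y =
  [&& x != y, ~~ e x y & [exists z, e x z && e z y]].
Proof.
rewrite at_distS dist_le1 negb_or andbC -andbA.
case: (boolP (x == y)) => // xy; case: (boolP (e x y)) => // exy.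
rewrite !andTb; apply/idP/existsP=> [/dist_le_last[|[z]]|[z /andP[h1 h2]]].
- by rewrite dist_le1 (negPf xy) (negPf exy).
- rewrite dist_le1 => /orP[/eqP <-|h1 h2]; first by rewrite (negPf exy).
  by exists z; rewrite h1.
- exact: dist_le_cons h1 (dist_le_edge h2).
Qed.

Lemma connect_dist_le x y : connect e x y -> exists n, dist_le e n x y.
Proof.
case/connectP=> p; elim: p x => [|z p IHp] x /=; first by move=> _ ->; exists 0; rewrite dist_le0.
case/andP=> h /IHp h' /h'[n hn]; exists n.+1; exact: dist_le_cons h hn.
Qed.

Lemma connect_closed (A : pred T) x : (forall x y, connect e x y) -> A x ->
  (forall y z, e y z -> A y -> A z) -> forall y, A y.
Proof.
move=> hc hx h y; have [n] := connect_dist_le (hc x y).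
elim: n y => [|n IHn] y; first by move=> /= /eqP <-.
by case/dist_le_last=> [/IHn//|[z /IHn hz /h]]; apply.
Qed.

Lemma at_dist_exists x y : connect e x y -> exists n, at_dist e n x y.
Proof.
move/connect_dist_le=> h; case: (ex_minnP h) => n hn hmin; exists n.
rewrite /at_dist hn /=; case: n hn hmin => //= n hn hmin.
by apply/negP=> /hmin; rewrite ltnn.
Qed.

End Distance.


(** * Amply regular graphs with diameter at least 4 *)

Definition nbrs (T : finType) (e : rel T) (x : T) : {set T} := [set y | e x y].

Lemma in_nbrs (T : finType) (e : rel T) x y : (y \in nbrs e x) = e x y.
Proof. by rewrite inE. Qed.

(** For [u] and [v] at distance 3 these are the neighbours of [u] on geodesics to [v], the set
    counted by the intersection number c_3. *)
Definition ball_nbrs (T : finType) (e : rel T) (u v : T) : {set T} :=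
  [set c | e u c && dist_le e 2 c v].

(** Seen from [y], this is the row of D3 in the quotient matrix: all neighbours of [a] but [x] lead
    back to distance 2. The 5-cube violates it, since a vertex at distance 3 there has two
    neighbours at distance 4. *)
Definition geodesic_closed (T : finType) (e : rel T) :=
  forall x y a n, at_dist e 4 x y -> e x a -> dist_le e 3 a y -> e a n ->
    n = x \/ dist_le e 2 n y.

Lemma sum_card_exchange (T : finType) (A B : {set T}) (r : rel T) :
  \sum_(a in A) #|[set b in B | r a b]| = \sum_(b in B) #|[set a in A | r a b]|.
Proof.
have E (X Y : {set T}) (s : rel T) :
    \sum_(a in X) #|[set b in Y | s a b]| = \sum_(a in X) \sum_(b in Y) s a b.
  apply: eq_bigr => a _; rewrite -sum1_card big_mkcond [RHS]big_mkcond /=.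
  by apply: eq_bigr => b _; rewrite inE; case: (b \in Y); case: (s a b).
by rewrite E exchange_big E.
Qed.

Section AmplyRegular.
Variables (T : finType) (e : rel T) (k lam mu : nat).
Hypotheses (eS : symmetric e) (eI : irreflexive e).
Hypothesis degH : forall x, #|nbrs e x| = k.
Hypothesis lamH : forall x y, e x y -> #|common_nbrs e x y| = lam.
Hypothesis muH : forall x y, at_dist e 2 x y -> #|common_nbrs e x y| = mu.
Hypotheses (mu_gt1 : 1 < mu) (k_eq : k = mu.*2.+1).
Implicit Types x y z a b c u v w n : T.

Lemma e_neq x y : e x y -> x != y.
Proof. by apply: contraTneq => ->; rewrite eI. Qed.

Lemma common_nbrsC x y : common_nbrs e x y = common_nbrs e y x.
Proof. by apply/setP=> z; rewrite !inE andbC. Qed.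

Lemma in_common x y z : (z \in common_nbrs e x y) = e x z && e y z.
Proof. by rewrite inE. Qed.

Lemma far_mid x y z : ~~ dist_le e 3 x y -> dist_le e 2 x z -> dist_le e 2 z y ->
  at_dist e 2 x z /\ at_dist e 2 z y.
Proof.
move=> far h1 h2; split; rewrite at_distS ?h1 ?h2 /=; apply: contra far => h.
  exact: (dist_le_trans (m := 1) h h2).
exact: (dist_le_trans (n := 1) h1 h).
Qed.

Lemma mid_split x y z : ~~ dist_le e 3 x y -> dist_le e 2 x z -> dist_le e 2 z y ->
  exists w, [/\ e z w, w \notin common_nbrs e z x, w \notin common_nbrs e z y &
    forall u, e z u -> [|| u \in common_nbrs e z x, u \in common_nbrs e z y | u == w]].
Proof.
move=> far h1 h2; have [d1 d2] := far_mid far h1 h2.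
set A := common_nbrs e z x; set B := common_nbrs e z y.
have cA : #|A| = mu by rewrite /A common_nbrsC muH.
have cB : #|B| = mu by rewrite /B muH.
have dAB : #|A :&: B| = 0.
  apply/eqP; rewrite cards_eq0; apply/eqP/setP=> t; rewrite !inE.
  apply: contraNF far => /andP[/andP[_ xt] /andP[_ yt]].
  apply: (dist_le_leq (m := 2)) => //; apply: (dist_le_cons xt); apply: dist_le_edge.
  by rewrite eS.
have /eqP/cards1P[w wE] : #|nbrs e z :\: (A :|: B)| = 1.
  rewrite cardsD (setIidPr _); last by apply/subsetP=> t; rewrite !inE => /orP[]/andP[].
  by rewrite degH cardsU cA cB dAB k_eq; lia.
have := set11 w; rewrite -wE in_setD in_setU negb_or in_nbrs => /andP[/andP[wA wB] zw].
exists w; split=> // u zu; apply/norP=> -[uA /norP[uB]].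
by rewrite -in_set1 -wE in_setD in_setU negb_or uA uB in_nbrs zu.
Qed.

(** Strikes out the second alternative of [mid_split]: a neighbour of [z] that is also adjacent to a
    neighbour of [x] is adjacent to [x] or is the exceptional [w]. *)
Lemma far_nbr_mid x y z a n : ~~ dist_le e 3 x y -> e x a -> e a n -> n \notin common_nbrs e z y.
Proof.
move=> far xa an; rewrite in_common; apply: contra far => /andP[_ yn].
apply: (dist_le_cons xa); apply: (dist_le_cons an); apply: dist_le_edge.
by rewrite eS.
Qed.

(** For [a] adjacent to [x] and [z], the [lam] common neighbours of [a] and [z] lie among the
    [mu - 1] other common neighbours of [x] and [z], together with [w]. *)
Lemma lam_le_mu x y z : ~~ dist_le e 3 x y -> dist_le e 2 x z -> dist_le e 2 z y ->
  lam <= mu.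
Proof.
move=> far h1 h2; have [d1 d2] := far_mid far h1 h2.
have [w [zw wA wB wP]] := mid_split far h1 h2.
have cA : #|common_nbrs e z x| = mu by rewrite common_nbrsC muH.
have /card_gt0P[a aA] : 0 < #|common_nbrs e z x| by rewrite cA ltnW.
have /andP[za xa] : e z a && e x a by rewrite -in_common.
rewrite -(lamH za); have <- : #|w |: (common_nbrs e z x :\ a)| = mu.
  have wA' : w \notin common_nbrs e z x :\ a by rewrite in_setD1 negb_and wA orbT.
  by rewrite cardsU1 wA' -cA [in RHS](cardsD1 a) aA.
apply/subset_leq_card/subsetP=> t; rewrite in_common => /andP[zt at_].
have := wP _ zt; rewrite (negPf (far_nbr_mid z far xa at_)) /= => /orP[tA|/eqP->].
  by rewrite !inE; rewrite in_common in tA; rewrite tA [t == a]eq_sym (e_neq at_) orbT.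
by rewrite !inE eqxx.
Qed.

Lemma triangle_free : lam = 0 -> forall b c d, e b c -> e b d -> ~~ e c d.
Proof.
move=> lam0 b c d bc bd; apply/negP=> cd; have := lamH bc; rewrite lam0 => /eqP.
by rewrite cards_eq0 => /eqP/setP/(_ d); rewrite !inE bd cd.
Qed.

Lemma card_common_nbrs : lam = 0 ->
  forall b c d, e b c -> e b d -> c != d -> #|common_nbrs e c d| = mu.
Proof.
move=> lam0 b c d bc bd cd; rewrite muH // at_dist2 // cd (triangle_free lam0 bc bd).
by apply/existsP; exists b; rewrite eS bc.
Qed.

Hypothesis lam_le : lam <= mu.

(** The edges between [C] and [D], the two ends of the geodesics from [u] to [v], form a bipartite
    graph in which every vertex has degree [mu]. So the two sets have equal size, at least [mu].
    Were the size [mu], that graph would be complete, and two vertices of [C] would have all of [D]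
    and also [u] in common, more than [lam] or [mu] allows. *)
Lemma card_ball_nbrs u v : dist_le e 3 u v -> ~~ dist_le e 2 u v ->
  mu < #|ball_nbrs e u v|.
Proof.
move=> duv nuv.
have mid s t c : ~~ dist_le e 2 s t -> c \in ball_nbrs e s t ->
    [set d in ball_nbrs e t s | e c d] = common_nbrs e c t /\ #|common_nbrs e c t| = mu.
  move=> nst; rewrite inE => /andP[sc ct].
  have nct : ~~ dist_le e 1 c t by apply: contra nst; apply: dist_le_cons.
  split; last by apply: muH; rewrite at_distS ct.
  apply/setP=> d; rewrite !inE; apply/idP/idP=> [/andP[/andP[-> _] ->]//|/andP[cd ->]].
  rewrite cd !andbT /=; apply: (@dist_le_cons _ _ 1 d c); first by rewrite eS.
  by apply: dist_le_edge; rewrite eS.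
have nvu : ~~ dist_le e 2 v u by apply: contra nuv; exact: dist_le_sym.
set C := ball_nbrs e u v; set D := ball_nbrs e v u.
have cCD : #|C| = #|D|.
  have := sum_card_exchange C D e.
  rewrite (eq_bigr (fun=> mu)); last by move=> c cC; have [-> ->] := mid _ _ _ nuv cC.
  rewrite [RHS](eq_bigr (fun=> mu)); last first.
    move=> d dD; have [E cE] := mid _ _ _ nvu dD.
    by rewrite -[RHS]cE -E; apply: eq_card => c; rewrite !inE [e c d]eS.
  rewrite !sum_nat_const => /eqP; rewrite eqn_pmul2r; last exact: ltnW.
  by move/eqP.
rewrite ltnNge; apply/negP=> leC.
have full s t c : ~~ dist_le e 2 s t -> #|ball_nbrs e t s| <= mu -> c \in ball_nbrs e s t ->
    ball_nbrs e t s \subset common_nbrs e c t.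
  move=> nst le cC; have [E cE] := mid _ _ _ nst cC.
  apply/setIidPl; apply/eqP; rewrite eqEcard subsetIl /=; apply: leq_trans le _.
  rewrite -{}cE -{}E; apply/subset_leq_card/subsetP=> d; rewrite !inE.
  by case/andP=> /andP[-> ->] ->.
have /card_gt0P[d0 d0D] : 0 < #|D|.
  case: (dist_le_first eS duv) => [h|[c uc cv]]; first by rewrite h in nuv.
  rewrite -cCD.
  by apply/card_gt0P; exists c; rewrite inE uc.
have /card_gt1P[c [c' [cC c'C cc']]] : 1 < #|C|.
  rewrite cCD; apply: (leq_trans mu_gt1).
  have /card_gt0P[c0 c0C] : 0 < #|C| by rewrite cCD; apply/card_gt0P; exists d0.
  have [<- <-] := mid _ _ _ nuv c0C.
  by apply/subset_leq_card/subsetP=> d; rewrite inE => /andP[].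
have uc : e u c by move: cC; rewrite inE => /andP[].
have uc' : e u c' by move: c'C; rewrite inE => /andP[].
have big : mu < #|common_nbrs e c c'|.
  have uD : u \notin D.
    rewrite inE negb_and; apply/orP; left; apply: contra nuv => vu.
    by apply: (dist_le_leq (m := 1)) => //; apply: dist_le_edge; rewrite eS.
  have cDmu : mu <= #|D|.
    have [<- <-] := mid _ _ _ nuv cC.
    by apply/subset_leq_card/subsetP=> d; rewrite inE => /andP[].
  have : #|u |: D| <= #|common_nbrs e c c'|.
    apply/subset_leq_card/subsetP=> d; rewrite in_setU1 in_common.
    case/orP=> [/eqP->|dD]; first by rewrite !(eS _ u) uc uc'.
    have leD : #|D| <= mu by rewrite -cCD.
    have /subsetP/(_ d dD) := full _ _ _ nuv leD cC.
    have /subsetP/(_ d dD) := full _ _ _ nuv leD c'C.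
    by rewrite !in_common => /andP[-> _] /andP[-> _].
  by rewrite cardsU1 uD; apply: leq_trans.
case: (boolP (e c c')) => [ecc|necc]; first by rewrite lamH // ltnNge lam_le in big.
rewrite muH ?ltnn // in big.
rewrite at_dist2 // cc' necc; apply/existsP; exists u.
by rewrite uc' eS uc.
Qed.

Lemma far_nbr x y a : ~~ dist_le e 3 x y -> e x a -> ~~ dist_le e 2 a y.
Proof. by move=> far xa; apply: contra far; apply: dist_le_cons. Qed.

Lemma ball_nbrs_mid x y a z : e x a -> z \in ball_nbrs e a y ->
  dist_le e 2 x z /\ dist_le e 2 z y.
Proof.
rewrite inE => xa /andP[az zy]; split=> //.
by apply: (dist_le_cons xa); apply: dist_le_edge.
Qed.

(** Count the edges between [C] and [L]. A vertex [z] of [C] has at least [lam - 1] neighbours in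
    [L], since only [w] can be lost. A vertex [b] of [L] has at most [lam - 1] in [C], since [x] is
    a common neighbour of [a] and [b] outside [C]. For [lam > 1] this gives [#|C| <= lam], against
    [#|C| > mu >= lam]. *)
Lemma lam_le1 x y a : ~~ dist_le e 3 x y -> e x a -> dist_le e 3 a y -> lam <= 1.
Proof.
move=> far xa ay; rewrite leqNgt; apply/negP=> lam_gt1.
have cC := card_ball_nbrs ay (far_nbr far xa).
set C := ball_nbrs e a y in cC; set L := common_nbrs e a x.
have cL : #|L| = lam by rewrite /L lamH // eS.
have le1 : #|C| * lam.-1 <= \sum_(z in C) #|[set b in L | e z b]|.
  rewrite -sum_nat_const; apply: leq_sum => z zC.
  have [xz zy] := ball_nbrs_mid xa zC.
  have [w [zw wA wB wP]] := mid_split far xz zy.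
  have az : e a z by move: zC; rewrite inE => /andP[].
  rewrite -(lamH az); apply: (@leq_trans #|common_nbrs e a z :\ w|).
    by rewrite (cardsD1 w (common_nbrs e a z)); case: (w \in _); rewrite ?leq_pred.
  apply/subset_leq_card/subsetP=> t; rewrite in_setD1 in_common => /andP[tw /andP[at_ zt]].
  have := wP _ zt; rewrite (negPf (far_nbr_mid z far xa at_)) (negPf tw) orbF.
  by rewrite !inE at_ zt /= orbF => ->.
have le2 : \sum_(b in L) #|[set z in C | e z b]| <= #|L| * lam.-1.
  rewrite -sum_nat_const; apply: leq_sum => b; rewrite in_common => /andP[ab xb].
  rewrite -(lamH ab) (cardsD1 x (common_nbrs e a b)) in_common !(eS _ x) xa xb /=.
  apply/subset_leq_card/subsetP=> z; rewrite !inE => /andP[/andP[az zy] zb].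
  rewrite az eS zb !andbT; apply: contraTneq zy => ->.
  by apply: contra far; apply: dist_le_leq.
have := leq_trans le1 (leq_trans (eq_leq (sum_card_exchange _ _ _)) le2).
rewrite cL leq_pmul2r; last by rewrite -ltnS prednK // ltnW.
by rewrite leqNgt (leq_ltn_trans lam_le cC).
Qed.

(** If [lam = 1], the third vertex [t] of the triangle on [a] and [z] is always [w]: were it
    adjacent to [x], the edge between [a] and [t] would lie in triangles with both [x] and [z]. Then
    all [mu] common neighbours of [x] and [z] are common neighbours of [z] and [w], too many. *)
Lemma lam_eq0 x y z : at_dist e 4 x y -> dist_le e 2 x z -> dist_le e 2 z y -> lam = 0.
Proof.
move=> /andP[dxy far] xz zy; have {}far : ~~ dist_le e 3 x y := far.
have [d1 d2] := far_mid far xz zy.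
have [w [zw wA wB wP]] := mid_split far xz zy.
have cA : #|common_nbrs e z x| = mu by rewrite common_nbrsC muH.
have /card_gt0P[a0] : 0 < #|common_nbrs e z x| by rewrite cA ltnW.
rewrite in_common => /andP[za0 xa0].
have : lam <= 1.
  apply: (lam_le1 far xa0); apply: (@dist_le_cons _ _ 2 _ z) => //; by rewrite eS.
case: (posnP lam) => // lam_gt0 lam1; have lam1E : lam = 1 by apply/eqP; rewrite eqn_leq lam1.
suff : mu <= lam by rewrite lam1E leqNgt mu_gt1.
rewrite -cA -(lamH zw); apply/subset_leq_card/subsetP=> a.
rewrite !in_common => /andP[za xa]; rewrite za /=.
have : 0 < #|common_nbrs e a z| by rewrite lamH // eS.
case/card_gt0P=> t; rewrite in_common => /andP[at_ zt].
have := wP _ zt; rewrite (negPf (far_nbr_mid z far xa at_)) in_common zt /=.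
case/orP=> [xt|/eqP<-]; last by rewrite eS.
have : 1 < #|common_nbrs e a t|.
  apply/card_gt1P; exists x, z; rewrite !in_common; split.
  - by rewrite !(eS _ x) xa xt.
  - by rewrite !(eS _ z) za zt.
  - by move: d1; rewrite at_dist2 // => /andP[].
by rewrite lamH // lam1E.
Qed.

(** Let [n] violate the conclusion and count the edges between [C] and [An], of size [mu - 1]. Each
    [z] in [C] keeps at least [mu - 2] neighbours in [An]: of the common neighbours of [n] and [z]
    only [a] and possibly [w] drop out. Each [b] in [An] has at most [mu - 2] in [C], because [x]
    and [n] are common neighbours of [a] and [b] outside [C]. Cancelling [mu - 2] contradicts
    [#|C| > mu]. *)
Lemma geodesic_closed_of_mu3 : lam = 0 -> 2 < mu -> geodesic_closed e.
Proof.
move=> lam0 mu3 x y a n /andP[_ far] xa ay an; have {}far : ~~ dist_le e 3 x y := far.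
case: (eqVneq n x) => [->|nx]; [by left | right; apply/negPn/negP=> ny].
have tri := triangle_free lam0; have cross := card_common_nbrs lam0.
have cC := card_ball_nbrs ay (far_nbr far xa).
set C := ball_nbrs e a y in cC.
have ax : e a x by rewrite eS.
have nx2 := tri _ _ _ an ax.
set An := common_nbrs e n x :\ a.
have cAn : #|An| = mu.-1.
  have := cross _ _ _ an ax nx; rewrite (cardsD1 a) in_common eS an xa /= => <-.
  by rewrite add1n.
have le1 : #|C| * (mu - 2) <= \sum_(z in C) #|[set b in An | e z b]|.
  rewrite -sum_nat_const; apply: leq_sum => z zC.
  have [xz zy] := ball_nbrs_mid xa zC.
  have [w [zw wA wB wP]] := mid_split far xz zy.
  have az : e a z by move: zC; rewrite inE => /andP[].
  have nz : n != z by apply: contraNneq ny => ->; move: zC; rewrite inE => /andP[].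
  rewrite -(cross _ _ _ an az nz).
  apply: (@leq_trans #|common_nbrs e n z :\ a :\ w|).
    rewrite (cardsD1 a (common_nbrs e n z)) in_common !(eS _ a) an az /=.
    rewrite (cardsD1 w (common_nbrs e n z :\ a)).
    by rewrite addnA leq_subLR leq_add2r; case: (w \in _).
  apply/subset_leq_card/subsetP=> t; rewrite in_setD1 in_setD1 in_common.
  case/and3P=> tw ta /andP[nt zt]; rewrite !inE ta nt zt andbT /=.
  have := wP _ zt; rewrite (negPf tw) orbF !in_common zt /= => /orP[//|yt].
  case/negP: ny; apply: (dist_le_cons nt); apply: dist_le_edge; by rewrite eS.
have le2 : \sum_(b in An) #|[set z in C | e z b]| <= #|An| * (mu - 2).
  rewrite -sum_nat_const; apply: leq_sum => b.
  rewrite in_setD1 in_common => /andP[ba /andP[nb xb]].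
  have ab : a != b by rewrite eq_sym.
  rewrite -(cross _ _ _ xa xb ab) (cardsD1 x (common_nbrs e a b)).
  rewrite in_common !(eS _ x) xa xb /= (cardsD1 n (_ :\ x)).
  rewrite in_setD1 in_common nx an eS nb /= addnA addKn.
  apply/subset_leq_card/subsetP=> z; rewrite !inE => /andP[/andP[az zy] zb].
  rewrite az (eS b) zb !andbT; apply/andP; split.
    by apply: contraNneq ny => <-.
  by apply: contraTneq zy => ->; apply: contra far; apply: dist_le_leq.
have := leq_trans le1 (leq_trans (eq_leq (sum_card_exchange _ _ _)) le2).
by rewrite cAn leq_pmul2r ?subn_gt0 // leqNgt (leq_ltn_trans (leq_pred _) cC).
Qed.

End AmplyRegular.


(** * Valency 5: exhaustive search over partial graphs *)

Definition nb (g : seq (seq nat)) (i : nat) : seq nat := nth [::] g i.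

Definition nmem (i : nat) (s : seq nat) : bool := has (eqn i) s.
Arguments nmem : simpl never.

Definition ins (g : seq (seq nat)) (p q : nat) : seq (seq nat) :=
  if nmem q (nb g p) then g else set_nth [::] g p (q :: nb g p).

Definition add_edge g p q := ins (ins g p q) q p.

(* Conditionals instead of boolean connectives, which [vm_compute] evaluates eagerly. *)
Definition ok_at (g : seq (seq nat)) (p : nat) : bool :=
  let np := nb g p in
  if 5 < size np then false else
  all (fun q => all (fun r =>
      if eqn r p then true else if nmem r np then false else
      size [seq s <- np | nmem r (nb g s)] <= 2) (nb g q)) np.

(** Paths [v], [u], [w] whose ends have so far only [u] in common. As [mu = 2], a fourth corner of a
    4-cycle is still owed. *)
Definition open_rects (g : seq (seq nat)) : seq (nat * nat * nat) :=
  flatten [seq let nu := nb g u in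
    flatten [seq let nv := nb g v in
      [seq (u, v, w) | w <- nu &
        if v < w then eqn (size [seq t <- nb g w | nmem t nv]) 1 else false] | v <- nu]
    | u <- iota 0 (size g)].

Definition rect_score (g : seq (seq nat)) (r : nat * nat * nat) : nat :=
  size (nb g r.1.2) + size (nb g r.2).

(** A heuristic: ends close to valency 5 leave few places for the missing corner. [search] checks
    the chosen triple itself, so soundness needs no property of the choice. *)
Definition choose_rect (g : seq (seq nat)) : option (nat * nat * nat) :=
  foldr (fun r best => if best is Some b then
      if rect_score g b < rect_score g r then Some r else best else Some r)
    None (open_rects g).

Definition close_rect g v w j := add_edge (add_edge g v j) w j.

(** The missing corner is an old vertex [j] or a new one, numbered [size g]. A branch cut by [ok_at]
    counts as [true], running out of fuel as [false], so the answer [true] certifies an exhausted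
    search tree whose leaves all pass [leaf]. *)
Fixpoint search (leaf : seq (seq nat) -> bool) (fuel : nat) (g : seq (seq nat)) : bool :=
  if fuel is fuel'.+1 then
    if choose_rect g is Some (u, v, w) then
      [&& u < size g, v \in nb g u, w \in nb g u, v != w,
        all (fun j => if nmem j [:: u; v; w] then true else
            let h := close_rect g v w j in
            if ok_at h j then if ok_at h v then if ok_at h w then
              search leaf fuel' h
            else true else true else true)
          (iota 0 (size g)) &
        let h := close_rect (rcons g [::]) v w (size g) in
        if ok_at h v then if ok_at h w then search leaf fuel' h else true else true]
    else leaf g
  else false.

Definition star5 : seq (seq nat) :=
  [:: [:: 1; 2; 3; 4; 5]; [:: 0]; [:: 0]; [:: 0]; [:: 0]; [:: 0]].


Definition full (g : seq (seq nat)) : bool := all (fun l => size l == 5) g.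

Definition grow (g : seq (seq nat)) (b : seq nat) : seq nat :=
  undup (b ++ flatten [seq nb g j | j <- b]).

Definition geodesic_closed_check (g : seq (seq nat)) : bool :=
  all (fun y =>
      let b2 := grow g (grow g [:: y]) in let b3 := grow g b2 in
      all (fun x => if nmem x b3 then true else
          all (fun a => if nmem a b3 then
              all (fun n => if eqn n x then true else nmem n b2) (nb g a)
            else true) (nb g x))
        (grow g b3))
    (iota 0 (size g)).

Definition iso_check (C : eqType) (c0 : C) (adj : rel C) (g : seq (seq nat))
    (lab : seq C) : bool :=
  if size lab != size g then false else
  uniq lab &&
  all (fun i => all (fun j =>
      adj (nth c0 lab i) (nth c0 lab j) == nmem j (nb g i)) (iota 0 (size g)))
    (iota 0 (size g)).

Definition cube_adj (s t : seq bool) : bool :=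
  count (fun p => p.1 != p.2) (zip s t) == 1.

(** Binary digits, lowest first, listed in the order in which the search numbers the vertices: 0 and
    the five powers of 2 label the initial star. *)
Definition cube_lab : seq (seq bool) :=
  [seq [seq odd (iter i half n) | i <- iota 0 5] | n <-
      [:: 0; 1; 2; 4; 8; 16; 24; 20; 28; 12; 18; 26; 22; 6; 30; 14; 10; 17;
      25; 21; 19; 3; 27; 23; 7; 31; 11; 15; 9; 13; 29; 5]].

(* A vertex [(b, (s, p))]: copy [b] of the biplane graph; [p] is a point if
   [s = false] and a block otherwise. *)
Definition K2_delta_adj (u w : bool * (bool * nat)) : bool :=
  let: (b, (s, p)) := u in let: (c, (t, q)) := w in
  if b != c then (s == t) && (p == q) else
  if s == t then false else
  let: (pt, bl) := if s then (q, p) else (p, q) in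
  ((pt + 7 - bl) %% 7) \in [:: 2; 4; 5; 6].

(* One isomorphism, found by computer, per leaf of the search isomorphic to [K2_box delta41]. *)
Definition K2_delta_labs : seq (seq (bool * (bool * nat))) :=
  [seq [seq let m := if 13 < n then n - 14 else n in
      (13 < n, (6 < m, if 6 < m then m - 7 else m)) | n <- l] | l <-
    [:: [:: 0; 8; 14; 9; 10; 12; 2; 4; 7; 6; 11; 1; 5; 3; 13; 26; 16; 18; 17;
      22; 25; 27; 15; 19; 20; 24; 21; 23];
      [:: 0; 14; 8; 9; 10; 12; 2; 4; 7; 6; 11; 1; 5; 3; 13; 26; 16; 18; 17;
      22; 25; 27; 15; 19; 20; 24; 21; 23];
      [:: 0; 8; 9; 10; 14; 12; 26; 2; 16; 24; 4; 18; 7; 5; 13; 19; 1; 3; 17;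
      11; 15; 27; 25; 23; 20; 6; 22; 21];
      [:: 0; 8; 9; 14; 10; 12; 2; 26; 16; 24; 4; 7; 18; 23; 21; 20; 19; 15;
      25; 22; 17; 11; 27; 13; 3; 5; 1; 6];
      [:: 0; 8; 9; 10; 12; 14; 26; 24; 16; 2; 23; 18; 15; 1; 25; 20; 17; 11;
      21; 22; 19; 7; 27; 13; 5; 3; 4; 6]]].

(** A partial graph with all valencies 5 is closed under adjacency, hence is the whole connected
    graph; a leaf that is not [full] would be a failure of the search. *)
Definition leaf_check (g : seq (seq nat)) : bool :=
  if ~~ full g then false else
  if geodesic_closed_check g then true else
  if iso_check [::] cube_adj g cube_lab then true else
  has (iso_check (false, (false, 0)) K2_delta_adj g) K2_delta_labs.

Lemma search_star5 : search leaf_check 100 star5.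
(* The fuel 100 bounds the number of 4-cycles closed along a branch. *)
Proof. by vm_compute. Qed.


Lemma nmemE i s : nmem i s = (i \in s).
Proof. by rewrite /nmem -has_pred1; apply: eq_has => j; rewrite eqnE eq_sym. Qed.

Lemma size_ins g p q : p < size g -> size (ins g p q) = size g.
Proof. by move=> h; rewrite /ins; case: ifP => // _; rewrite size_set_nth; apply/maxn_idPr. Qed.

Lemma nb_ins g p q i : nb (ins g p q) i =
  if (i == p) && (q \notin nb g p) then q :: nb g p else nb g i.
Proof.
rewrite /ins nmemE; case: (q \in nb g p); rewrite /= ?andbF ?andbT // /nb.
by rewrite nth_set_nth.
Qed.

(** * Soundness of the search *)

Section Search.
Variables (T : finType) (e : rel T).
Hypotheses (eS : symmetric e) (eI : irreflexive e).
Hypothesis deg5 : forall x, #|nbrs e x| = 5.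
Hypothesis tri : forall b c d, e b c -> e b d -> ~~ e c d.
Hypothesis cross : forall b c d, e b c -> e b d -> c != d -> #|common_nbrs e c d| = 2.
Implicit Types (g : seq (seq nat)) (f : nat -> T).

(** Edges are preserved but not reflected: an edge absent from [g] is undecided, not forbidden. *)
Definition embedded g f :=
  [/\ forall i j, i < size g -> j < size g -> f i = f j -> i = j,
      forall i j, i < size g -> j \in nb g i -> (j < size g) && e (f i) (f j) &
      forall i, uniq (nb g i)].

Lemma card_embedded g f s (A : {set T}) : embedded g f -> uniq s ->
  {in s, forall i, (i < size g) && (f i \in A)} -> size s <= #|A|.
Proof.
case=> inj _ _ us sA; rewrite -(size_map f) cardE; apply: uniq_leq_size.
  rewrite map_inj_in_uniq // => i j /sA/andP[hi _] /sA/andP[hj _]; exact: inj.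
by move=> _ /mapP[i /sA/andP[_ iA] ->]; rewrite mem_enum.
Qed.

Lemma ins_embedded g f p q : p < size g -> q < size g -> e (f p) (f q) ->
  embedded g f -> embedded (ins g p q) f.
Proof.
move=> hp hq epq [inj edge un]; split; rewrite ?size_ins // => i.
  move=> j hi; rewrite nb_ins; case: ifP => [/andP[/eqP-> _]|_]; last exact: edge.
  by rewrite inE => /orP[/eqP->|/edge]; [rewrite hq|apply].
by rewrite nb_ins; case: ifP => [/andP[_ qp]|_]; rewrite ?cons_uniq ?qp un.
Qed.

Lemma add_edge_embedded g f p q : p < size g -> q < size g -> e (f p) (f q) ->
  embedded g f -> embedded (add_edge g p q) f.
Proof.
move=> hp hq epq h; apply: ins_embedded; rewrite ?size_ins //; first by rewrite eS.
exact: ins_embedded.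
Qed.

Lemma size_close_rect g v w j : v < size g -> w < size g -> j < size g ->
  size (close_rect g v w j) = size g.
Proof. by move=> hv hw hj; rewrite /close_rect /add_edge !size_ins. Qed.

Lemma close_rect_embedded g f v w j : v < size g -> w < size g -> j < size g ->
  e (f v) (f j) -> e (f w) (f j) -> embedded g f -> embedded (close_rect g v w j) f.
Proof.
move=> hv hw hj ev ew h; apply: add_edge_embedded => //; try by rewrite /add_edge !size_ins.
exact: add_edge_embedded.
Qed.

Lemma ok_at_embedded g f p : embedded g f -> p < size g -> ok_at g p.
Proof.
move=> h hp; have [inj edge un] := h; rewrite /ok_at ltnNge.
have -> /= : size (nb g p) <= 5.
  rewrite -(deg5 (f p)); apply: (card_embedded h) => // i /(edge p i hp)/andP[-> /=].
  by rewrite in_nbrs.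
apply/allP=> q qp; apply/allP=> r rq; rewrite eqnE; case: eqP => // /eqP rp.
have /andP[hq epq] := edge _ _ hp qp; have /andP[hr eqr] := edge _ _ hq rq.
rewrite nmemE; case: ifP => [/(edge _ _ hp)/andP[_ epr]|_].
  by have := tri epq epr; rewrite eqr.
have frp : f p != f r by apply: contraNneq rp => /inj -> //.
have eqp : e (f q) (f p) by rewrite eS.
rewrite -(cross eqp eqr frp); apply: (card_embedded h).
  exact: filter_uniq.
move=> s; rewrite mem_filter nmemE => /andP[rs sp].
have /andP[hs eps] := edge _ _ hp sp; have /andP[_ esr] := edge _ _ hs rs.
by rewrite hs in_common eps eS esr.
Qed.

Lemma new_vertex_embedded g f t : embedded g f -> (forall i, i < size g -> t != f i) ->
  embedded (rcons g [::]) (fun i => if i == size g then t else f i).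
Proof.
case=> inj edge un new.
have nbE i : nb (rcons g [::]) i = nb g i.
  by rewrite /nb nth_rcons; case: ltngtP => // [h|->]; rewrite nth_default // ltnW.
split=> [i j|i j|i]; rewrite ?size_rcons ?nbE ?ltnS //.
  rewrite (leq_eqVlt i) (leq_eqVlt j).
  case/orP=> [/eqP->|hi]; case/orP=> [/eqP->|hj]; rewrite ?eqxx ?(ltn_eqF hi) ?(ltn_eqF hj) //.
  - by move=> E; have := new _ hj; rewrite E eqxx.
  - by move=> E; have := new _ hi; rewrite E eqxx.
  - exact: inj.
rewrite leq_eqVlt => /orP[/eqP->|hi]; first by rewrite /nb nth_default.
by move=> /(edge _ _ hi)/andP[hj eij]; rewrite (ltnW hj) (ltn_eqF hi) (ltn_eqF hj).
Qed.

(** The graph itself selects the branch: the second common neighbour [t] of [f v] and [f w] is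
    either some [f j] or a vertex not yet reached. The enlarged partial graph is again embedded, so
    by [ok_at_embedded] this branch is never cut. *)
Lemma search_sound leaf fuel g f : search leaf fuel g -> 0 < size g -> embedded g f ->
  exists h f', [/\ leaf h, 0 < size h & embedded h f'].
Proof.
elim: fuel g f => // n IHn g f /=; case: (choose_rect g) => [[[u v] w]|]; last first.
  by move=> hg hs hf; exists g, f.
case/and5P=> hu vu wu vw /andP[/allP old new] hs h; have [inj edge un] := h.
have /andP[hv euv] := edge _ _ hu vu; have /andP[hw euw] := edge _ _ hu wu.
have fvw : f v != f w by apply: contraNneq vw => /inj ->.
have : 1 < #|common_nbrs e (f v) (f w)| by rewrite (cross euv euw fvw).
rewrite (cardsD1 (f u)) in_common !(eS _ (f u)) euv euw /= ltnS => /card_gt0P[t].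
rewrite in_setD1 in_common => /andP[tu /andP[evt ewt]].
have [/hasP[j]|/hasPn nt] := boolP (has (fun j => f j == t) (iota 0 (size g))).
  rewrite mem_iota /= add0n => hj /eqP ft; subst t.
  have hj' : j \in iota 0 (size g) by rewrite mem_iota.
  have := old j hj'; rewrite nmemE !inE.
  have [ju|_] /= := eqVneq j u; first by rewrite ju eqxx in tu.
  have [jv|_] /= := eqVneq j v; first by rewrite jv eI in evt.
  have [jw|_] /= := eqVneq j w; first by rewrite jw eI in ewt.
  have h' := close_rect_embedded hv hw hj evt ewt h.
  have S := size_close_rect hv hw hj.
  rewrite !(ok_at_embedded h') ?S // => hs'; apply: (IHn _ f hs' _ h').
  by rewrite S.
set f' := fun i => if i == size g then t else f i.
have f'E i : i < size g -> f' i = f i by move=> hi; rewrite /f' (ltn_eqF hi).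
have f'n : f' (size g) = t by rewrite /f' eqxx.
have h1 : embedded (rcons g [::]) f'.
  by apply: new_vertex_embedded => // i hi; rewrite eq_sym; apply: nt; rewrite mem_iota.
have hv' : v < size (rcons g [::]) by rewrite size_rcons ltnW.
have hw' : w < size (rcons g [::]) by rewrite size_rcons ltnW.
have hn : size g < size (rcons g [::]) by rewrite size_rcons.
have h2 : embedded (close_rect (rcons g [::]) v w (size g)) f'.
  by apply: close_rect_embedded => //; rewrite f'n f'E.
have S := size_close_rect hv' hw' hn.
move: new; rewrite !(ok_at_embedded h2) ?S // => hs'; apply: (IHn _ f' hs' _ h2).
by rewrite S size_rcons.
Qed.

Lemma star5_embedded (x : T) : exists f, embedded star5 f.
Proof.
have sz : size (enum (nbrs e x)) = 5 by rewrite -cardE deg5.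
have un : uniq (x :: enum (nbrs e x)) by rewrite cons_uniq enum_uniq mem_enum in_nbrs eI.
exists (nth x (x :: enum (nbrs e x))); split.
- move=> i j hi hj /eqP; rewrite nth_uniq //= ?sz //; exact: eqP.
- have E i : i < 5 -> e x (nth x (enum (nbrs e x)) i).
    by move=> hi; rewrite -in_nbrs -mem_enum mem_nth ?sz.
  case=> [|i] j hi.
    rewrite -[nb _ _]/(iota 1 5) mem_iota; case: j => // j hj.
    by have hj' : j < 5 by []; rewrite /= E // andbT.
  have -> : nb star5 i.+1 = [:: 0] by case: i hi => [|[|[|[|[|i]]]]].
  by rewrite inE => /eqP->; rewrite /= eS E.
- by case=> [|[|[|[|[|[|i]]]]]]; rewrite // /nb nth_default.
Qed.

(** * Leaves of the search are the whole graph *)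

Section Leaf.
Variables (g : seq (seq nat)) (f : nat -> T).
Hypotheses (gf : embedded g f) (g_full : full g) (g0 : 0 < size g).
Hypothesis econ : forall x y, connect e x y.

(** The five listed neighbours have five distinct images in a neighbourhood of size 5. *)
Lemma leaf_nbr i t : i < size g -> e (f i) t -> exists2 j, j \in nb g i & t = f j.
Proof.
move=> hi eit; have [inj edge un] := gf.
have sz : size (nb g i) = 5 by apply/eqP/(allP g_full)/mem_nth.
have uf : uniq (map f (nb g i)).
  rewrite map_inj_in_uniq // => a b /(edge _ _ hi)/andP[ha _] /(edge _ _ hi)/andP[hb _].
  exact: inj.
have sub : {subset map f (nb g i) <= enum (nbrs e (f i))}.
  by move=> _ /mapP[j /(edge _ _ hi)/andP[_ h] ->]; rewrite mem_enum in_nbrs.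
have [|_ E] := uniq_min_size uf sub; first by rewrite size_map sz -cardE deg5.
by have := E t; rewrite mem_enum in_nbrs eit => /mapP[j]; exists j.
Qed.

Lemma leaf_onto t : exists2 i, i < size g & t = f i.
Proof.
pose A := [pred t | has (fun i => t == f i) (iota 0 (size g))].
have AP s : A s -> exists2 i, i < size g & s = f i.
  by case/hasP=> i; rewrite mem_iota => hi /eqP; exists i.
apply: (AP); apply: (connect_closed econ (x := f 0)).
  by apply/hasP; exists 0; rewrite ?mem_iota.
move=> y z eyz /AP[i hi yE]; subst y; have [j jn ->] := leaf_nbr hi eyz.
have [_ edge _] := gf; have /andP[hj _] := edge _ _ hi jn.
by apply/hasP; exists j; rewrite ?mem_iota.
Qed.

Lemma leaf_edge i j : i < size g -> j < size g -> e (f i) (f j) = (j \in nb g i).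
Proof.
move=> hi hj; have [inj edge _] := gf; apply/idP/idP=> [/(leaf_nbr hi)[a an]|].
  by have /andP[ha _] := edge _ _ hi an; move/inj=> ->.
by move/(edge _ _ hi)/andP=> [].
Qed.

Lemma mem_grow r y b : (forall j, j \in b -> j < size g) ->
  (forall j, j < size g -> (j \in b) = dist_le e r (f j) (f y)) ->
  (forall j, j \in grow g b -> j < size g) /\
  (forall j, j < size g -> (j \in grow g b) = dist_le e r.+1 (f j) (f y)).
Proof.
have [inj edge _] := gf; move=> hb bE.
have E j : (j \in grow g b) = (j \in b) || (j \in flatten [seq nb g i | i <- b]).
  by rewrite mem_undup mem_cat.
split=> j; rewrite E.
  by case/orP=> [/hb//|/flattenP[_ /mapP[i ib ->] /(edge _ _ (hb _ ib))/andP[]]].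
move=> hj; apply/idP/idP.
  case/orP=> [|/flattenP[_ /mapP[i ib ->] ji]]; first by rewrite bE // => /dist_leS.
  have /andP[_ eij] := edge _ _ (hb _ ib) ji.
  by apply: (@dist_le_cons _ _ _ _ (f i)); [rewrite eS | rewrite -bE ?hb].
case/(dist_le_first eS) => [|[t et dt]]; first by rewrite -bE // => ->.
have [i ij tE] := leaf_nbr hj et; subst t; have /andP[hi eji] := edge _ _ hj ij.
apply/orP; right; apply/flattenP; exists (nb g i); last by rewrite -leaf_edge // eS.
by apply/mapP; exists i; rewrite // bE.
Qed.

Lemma geodesic_closed_leaf : geodesic_closed_check g -> geodesic_closed e.
Proof.
move=> /allP chk x' y' a' n' d4; have [inj edge _] := gf.
have [x hx ?] := leaf_onto x'; have [y hy ?] := leaf_onto y'; subst x' y'.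
move=> xa d3 an; have [a ax ?] := leaf_nbr hx xa; subst a'.
have /andP[ha _] := edge _ _ hx ax.
have [n na ?] := leaf_nbr ha an; subst n'; have /andP[hn _] := edge _ _ ha na.
have y_in : y \in iota 0 (size g) by rewrite mem_iota.
have := chk _ y_in; rewrite /=.
set b2 := grow g (grow g _); set b3 := grow g b2; set b4 := grow g b3.
have E0 : (forall j, j \in [:: y] -> j < size g) /\
    (forall j, j < size g -> (j \in [:: y]) = dist_le e 0 (f j) (f y)).
  split=> j; rewrite inE; first by move/eqP->.
  by move=> hj; apply/eqP/eqP=> [->//|/inj ->].
have E1 := mem_grow E0.1 E0.2; have E2 := mem_grow E1.1 E1.2.
have E3 := mem_grow E2.1 E2.2; have E4 := mem_grow E3.1 E3.2.
rewrite -/b2 -/b3 -/b4 in E2 E3 E4.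
move: d4; rewrite at_distS -E4.2 // -E3.2 // => /andP[x4 /negPf x3] /allP/(_ _ x4).
rewrite nmemE x3 => /allP/(_ _ ax); rewrite nmemE E3.2 // d3 => /allP/(_ _ na).
rewrite eqnE nmemE E2.2 //; case: eqP => [-> _|_ h]; by [left|right].
Qed.

(** Labels live in a type [C] suited to computation; [good] singles out the codes on which [dec] is
    faithful. The map obtained is injective, and bijective by cardinality, as
    [#|T'| = size g <= #|T|]. *)
Lemma iso_leaf (T' : finType) (e' : rel T') (C : eqType) (c0 : C) (adj : rel C)
    (dec : C -> T') (good : pred C) lab :
  iso_check c0 adj g lab -> all good lab -> size lab = #|T'| ->
  {in good &, forall a b, e' (dec a) (dec b) = adj a b} ->
  {in good &, injective dec} -> graph_iso e e'.
Proof.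
rewrite /iso_check; case: eqP => //= sz /andP[ul /allP chk] /allP gl cl adjE decI.
have [inj edge _] := gf.
pose idx t := find (fun i => t == f i) (iota 0 (size g)).
have idxP t : idx t < size g /\ f (idx t) = t.
  have : has (fun i => t == f i) (iota 0 (size g)).
    by have [i hi ->] := leaf_onto t; apply/hasP; exists i; rewrite ?mem_iota.
  move=> h; have := nth_find 0 h; rewrite has_find size_iota in h.
  by rewrite nth_iota // add0n => /eqP.
pose c t := nth c0 lab (idx t).
have cg t : c t \in good by apply/gl/mem_nth; rewrite sz (idxP t).1.
have cI : injective (dec \o c).
  move=> s t /= /decI; move=> /(_ (cg s) (cg t))/eqP.
  rewrite nth_uniq ?sz ?(idxP _).1 // => /eqP st.
  by rewrite -(idxP s).2 st (idxP t).2.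
exists (dec \o c); split.
  apply: inj_card_bij => //; rewrite -cl sz -(size_iota 0 (size g)) -cardsT.
  apply: (card_embedded gf); first exact: iota_uniq.
  by move=> i; rewrite mem_iota add0n inE andbT.
move=> s t; rewrite /= adjE //.
have in_iota u : idx u \in iota 0 (size g) by rewrite mem_iota (idxP u).1.
have /allP/(_ _ (in_iota t))/eqP -> := chk _ (in_iota s).
by rewrite nmemE -leaf_edge ?(idxP _).1 // !(idxP _).2.
Qed.

End Leaf.

Lemma iso_cube5 g f : embedded g f -> full g -> 0 < size g ->
  (forall x y, connect e x y) -> iso_check [::] cube_adj g cube_lab -> graph_iso e cube5.
Proof.
move=> gf gfull g0 econ h.
pose dec (s : seq bool) : {ffun 'I_5 -> bool} := [ffun i : 'I_5 => nth false s i].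
apply: (iso_leaf gf gfull g0 econ (dec := dec) (good := fun s => size s == 5) h).
- by vm_compute.
- by rewrite card_ffun card_bool card_ord.
- move=> s t /eqP hs /eqP ht; rewrite /cube5 /cube_adj; congr (_ == 1).
  rewrite -sum1_card -sum1_count (big_nth (false, false)) size_zip hs ht minnn big_mkord.
  by apply: eq_bigl => i; rewrite inE !ffunE nth_zip ?hs ?ht.
- move=> s t /eqP hs /eqP ht /ffunP E; apply: (@eq_from_nth _ false); rewrite ?hs ?ht // => i hi.
  by have := E (Ordinal hi); rewrite !ffunE.
Qed.

Lemma iso_K2_delta41 g f : embedded g f -> full g -> 0 < size g ->
  (forall x y, connect e x y) ->
  has (iso_check (false, (false, 0)) K2_delta_adj g) K2_delta_labs ->
  graph_iso e (K2_box delta41).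
Proof.
move=> gf gfull g0 econ /hasP[lab labP h].
pose dec (u : bool * (bool * nat)) : bool * ('I_7 + 'I_7) :=
  (u.1, if u.2.1 then inr (inord u.2.2) else inl (inord u.2.2)).
pose good (u : bool * (bool * nat)) := u.2.2 < 7.
have /andP[lab_good /eqP lab_size] : all good lab && (size lab == 28).
  have : all (fun l => all good l && (size l == 28)) K2_delta_labs by vm_compute.
  by move/allP/(_ _ labP).
have inordI p q : p < 7 -> q < 7 -> (inord p == inord q :> 'I_7) = (p == q).
  by move=> hp hq; rewrite -val_eqE /= !inordK.
apply: (iso_leaf gf gfull g0 econ (dec := dec) (good := good) h) => //.
- by rewrite card_prod card_sum card_bool !card_ord lab_size.
- move=> [b [s p]] [c [t q]]; rewrite !unfold_in /good /= => hp hq; rewrite /K2_box /dec /=.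
  by case: s; case: t; case: (eqVneq b c) => [_|_] /=;
    rewrite /biplane_inc /= ?inordK ?orbF ?andbF //
      ?(inj_eq (@inl_inj _ _)) ?(inj_eq (@inr_inj _ _)) ?inordI.
- move=> [b [s p]] [c [t q]]; rewrite !unfold_in /good /= => hp hq; rewrite /dec /= => -[<-].
  by case: s; case: t => // -[/eqP]; rewrite inordI // => /eqP ->.
Qed.

Lemma valency5_cases (x : T) : (forall x y, connect e x y) ->
  [\/ graph_iso e cube5, graph_iso e (K2_box delta41) | geodesic_closed e].
Proof.
move=> econ; have [f0 h0] := star5_embedded x.
have [g [f [chk g0 gf]]] := search_sound search_star5 isT h0.
move: chk; rewrite /leaf_check; case: ifPn => // /negPn gfull.
case: ifP => [h _|_]; first by constructor 3; exact: (geodesic_closed_leaf gf gfull g0 econ h).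
case: ifP => [h _|_ h]; [constructor 1|constructor 2].
  exact: iso_cube5 gf gfull g0 econ h.
exact: iso_K2_delta41 gf gfull g0 econ h.
Qed.

End Search.


(** * The distance partition of a geodesically closed graph *)

Section GeodesicallyClosed.
Variables (T : finType) (e : rel T) (k mu : nat).
Hypotheses (eS : symmetric e) (eI : irreflexive e).
Hypothesis degH : forall x, #|nbrs e x| = k.
Hypothesis tri : forall b c d, e b c -> e b d -> ~~ e c d.
Hypothesis cross : forall b c d, e b c -> e b d -> c != d -> #|common_nbrs e c d| = mu.
Hypotheses (mu_gt1 : 1 < mu) (k_eq : k = mu.*2.+1).
Hypothesis econ : forall x y, connect e x y.
Hypothesis closed : geodesic_closed e.
Implicit Types x y z a b c u v w : T.

Local Lemma mu_gt0 : 0 < mu. Proof. exact: ltnW. Qed.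
Local Lemma k_gt0 : 0 < k. Proof. by rewrite k_eq. Qed.

Lemma at_dist2_card x y : at_dist e 2 x y -> #|common_nbrs e x y| = mu.
Proof.
rewrite at_dist2 // => /and3P[xy _ /existsP[z /andP[xz zy]]].
by apply: (cross (b := z)); rewrite // eS.
Qed.

Lemma at_dist2_path x z y : e x z -> e z y -> x != y -> at_dist e 2 x y.
Proof.
move=> xz zy xy; rewrite at_dist2 // xy (tri (b := z)) // 1?eS //=.
by apply/existsP; exists z; rewrite xz.
Qed.

Lemma common_cardD1 x y z : e z x -> e z y -> x != y ->
  #|common_nbrs e x y :\ z| = mu.-1.
Proof.
move=> zx zy xy; rewrite -(cross zx zy xy) (cardsD1 z (common_nbrs e x y)).
by rewrite in_common !(eS _ z) zx zy.
Qed.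

(** Count the 4-cycles [u], [v], [c], [w] with [w] in [X]. Each [w] other than [v] admits [mu - 1]
    choices of [c]; each neighbour [c] of [v] other than [u] admits [mu - 1] choices of [w], since
    [X] contains every fourth corner. Hence [X] without [v] has [k - 1] elements. *)
Lemma rect_full u v (X : {set T}) : v \in X -> X \subset nbrs e u ->
  (forall c v', e v c -> c != u -> e v' c -> e u v' -> v' \in X) -> X = nbrs e u.
Proof.
move=> vX XN rect; apply/eqP; rewrite eqEcard XN degH /=.
have uX w : w \in X -> e u w by move/(subsetP XN); rewrite in_nbrs.
have uv := uX _ vX.
have := sum_card_exchange (X :\ v) (nbrs e v :\ u) e.
rewrite (eq_bigr (fun=> mu.-1)); last first.
  move=> w; rewrite in_setD1 => /andP[wv wX].
  rewrite -(common_cardD1 uv (uX _ wX)) 1?eq_sym //; apply: eq_card => c.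
  by rewrite !inE -andbA.
rewrite [RHS](eq_bigr (fun=> mu.-1)); last first.
  move=> c; rewrite in_setD1 in_nbrs => /andP[cu vc].
  have vu : e v u by rewrite eS.
  rewrite -(common_cardD1 vu vc) 1?eq_sym //; apply: eq_card => w.
  rewrite !inE -andbA; case: (w != v) => //=; apply/andP/andP=> -[].
    by move/uX=> uw wc; rewrite uw eS.
  by move=> uw; rewrite eS => wc; rewrite (rect c).
rewrite !sum_nat_const => /eqP; rewrite eqn_pmul2r; last by rewrite -ltnS prednK ?mu_gt0.
have := cardsD1 v X; have := cardsD1 u (nbrs e v).
by rewrite vX in_nbrs eS uv degH => -> -> /eqP->.
Qed.

(** Counting edges from the neighbours of [u] outwards gives [k * (k - 1)] on one side and [mu] per
    vertex on the other, with [k - 1 = 2 * mu]. *)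
Lemma card_at_dist2 u : #|[set z | at_dist e 2 u z]| = 2 * k.
Proof.
have := sum_card_exchange (nbrs e u) [set z | at_dist e 2 u z] e.
rewrite (eq_bigr (fun=> k.-1)); last first.
  move=> a; rewrite in_nbrs => ua.
  have := cardsD1 u (nbrs e a); rewrite in_nbrs eS ua degH add1n => /(congr1 predn)/= ->.
  apply: eq_card => z; rewrite !inE; apply/andP/andP=> -[].
    by rewrite at_dist2 // eq_sym => /and3P[].
  by move=> zu az; split=> //; apply: at_dist2_path ua az _; rewrite eq_sym.
rewrite [RHS](eq_bigr (fun=> mu)); last first.
  move=> z; rewrite inE => uz; rewrite -(at_dist2_card uz).
  by apply: eq_card => a; rewrite !inE [e a z]eS.
rewrite !sum_nat_const degH => E; apply/eqP; rewrite -(eqn_pmul2r mu_gt0) -E k_eq /=.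
by rewrite -mulnA mulnCA mul2n.
Qed.

(** By [rect_full] for the neighbours of [x] on geodesics to [y]: for such a [v], closedness puts
    the next corner [c] within distance 2 of [y], hence the fourth corner within 3. *)
Lemma geodesic_full x y a : at_dist e 4 x y -> e x a -> dist_le e 3 a y.
Proof.
move=> d4; have /andP[d4le far] := d4.
have {}far : ~~ dist_le e 3 x y := far.
case: (dist_le_first eS d4le) => [h|[v xv vy]]; first by rewrite h in far.
rewrite -in_nbrs -(@rect_full x v [set a | e x a && dist_le e 3 a y]).
- by rewrite inE => /andP[].
- by rewrite inE xv.
- by apply/subsetP=> w; rewrite !inE => /andP[].
move=> c v' vc cx v'c xv'; rewrite inE xv' /=.
have [cE|cy] := closed d4 xv vy vc; first by rewrite cE eqxx in cx.
exact: dist_le_cons v'c cy.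
Qed.

Lemma mid_nbr x y a n : at_dist e 4 x y -> e x a -> e a n -> n != x ->
  at_dist e 2 x n /\ dist_le e 2 n y.
Proof.
move=> d4 xa an nx; split; first by apply: at_dist2_path xa an _; rewrite eq_sym.
have [nE|//] := closed d4 xa (geodesic_full d4 xa) an.
by rewrite nE eqxx in nx.
Qed.

(** Every path of length 2 from [x] to another vertex ends within distance 2 of [y], and the roles
    of [x] and [y] can be exchanged. *)
Lemma mid_at_dist2 x y z : at_dist e 4 x y -> at_dist e 2 x z = at_dist e 2 y z.
Proof.
have half s t : at_dist e 4 s t -> at_dist e 2 s z -> at_dist e 2 t z.
  move=> d4 sz; have /andP[_ far] := d4.
  move: (sz); rewrite at_dist2 // => /and3P[ns _ /existsP[a /andP[sa az]]].
  rewrite eq_sym in ns; have [_ zt] := mid_nbr d4 sa az ns.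
  apply: at_dist_sym => //.
  by case: (far_mid (x := s) far _ zt) => //; move: sz; rewrite at_distS => /andP[].
by move=> d4; apply/idP/idP; apply: half => //; apply: at_dist_sym.
Qed.

Lemma at_dist_not m n x y : at_dist e n x y -> m < n -> ~~ dist_le e m x y.
Proof.
case: n => // n; rewrite at_distS => /andP[_] h mn; apply: contra h.
exact: dist_le_leq.
Qed.

Lemma mid_split2 x y z : at_dist e 4 x y -> at_dist e 2 x z ->
  exists w, [/\ e z w, ~~ e x w, ~~ e y w & forall u, e z u -> [|| e x u, e y u | u == w]].
Proof.
move=> d4 xz; have yz := xz; rewrite (mid_at_dist2 _ d4) in yz.
have far := at_dist_not (m := 3) d4 isT.
have xz2 : dist_le e 2 x z by move: xz; rewrite at_distS => /andP[].
have zy2 : dist_le e 2 z y by move: (at_dist_sym eS yz); rewrite at_distS => /andP[].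
have [w [zw wA wB wP]] := mid_split eS degH at_dist2_card mu_gt1 k_eq far xz2 zy2.
exists w; move: wA wB; rewrite !in_common zw; split=> // u zu.
by have := wP u zu; rewrite !in_common zu.
Qed.

(** A middle neighbour of [z'] must be its exceptional neighbour [w], so [z = w]. For [a] adjacent
    to [x] and [z], the vertices [a] and [z'] have a second common neighbour [c] besides [z]. It
    differs from [x], so it is again in the middle and must equal [w] too. *)
Lemma mid_indep x y z z' : at_dist e 4 x y -> at_dist e 2 x z -> at_dist e 2 x z' ->
  ~~ e z z'.
Proof.
move=> d4 xz xz'; apply/negP=> zz'.
have [w [_ _ _ wP]] := mid_split2 d4 xz'.
have wE u : at_dist e 2 x u -> e z' u -> u = w.
  move=> xu /wP; have yu := xu; rewrite (mid_at_dist2 _ d4) in yu.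
  move: xu yu; rewrite !at_dist2 // => /and3P[_ /negPf-> _] /and3P[_ /negPf-> _] /=.
  by move/eqP.
have /card_gt0P[a] : 0 < #|common_nbrs e x z| by rewrite at_dist2_card ?mu_gt0.
rewrite in_common => /andP[xa za].
have az' : a != z'.
  by apply: contraTneq xa => ->; move: xz'; rewrite at_dist2 // => /and3P[].
have az : e a z by rewrite eS.
have : 1 < #|common_nbrs e a z'| by rewrite (cross za zz' az').
rewrite (cardsD1 z) in_common az eS zz' /= ltnS => /card_gt0P[c].
rewrite in_setD1 in_common => /andP[cz /andP[ac z'c]]; case/eqP: cz.
have cx : c != x.
  apply: contraTneq z'c => ->; rewrite eS.
  by move: xz'; rewrite at_dist2 // => /and3P[].
have [xc _] := mid_nbr d4 xa ac cx.
have zw : z = w by apply: wE xz _; rewrite eS.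
by rewrite zw (wE c xc z'c).
Qed.

(** * The bipartition *)

Definition even_half x y : {set T} := [set u | [|| u == x, u == y | at_dist e 2 x u]].

Lemma even_half_sym x y : at_dist e 4 x y -> even_half x y = even_half y x.
Proof. by move=> d4; apply/setP=> u; rewrite !inE (mid_at_dist2 _ d4) orbCA. Qed.

Lemma even_half_indep x y u w : at_dist e 4 x y -> u \in even_half x y ->
  w \in even_half x y -> ~~ e u w.
Proof.
move=> d4; have nxy : ~~ e x y.
  by apply: contra (at_dist_not (m := 1) d4 isT); exact: dist_le_edge.
have nxz z : at_dist e 2 x z -> ~~ e x z by rewrite at_dist2 // => /and3P[].
have nyz z : at_dist e 2 x z -> ~~ e y z.
  by rewrite (mid_at_dist2 _ d4) at_dist2 // => /and3P[].
rewrite !inE => /or3P[/eqP->|/eqP->|hu] /or3P[/eqP->|/eqP->|hw]; rewrite ?eI //.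
- exact: nxz.
- by rewrite eS.
- exact: nyz.
- by rewrite eS nxz.
- by rewrite eS nyz.
- exact: mid_indep d4 hu hw.
Qed.

(** The predicate [A] is propagated along edges from [x]. The one hard case is a neighbour [w] of a
    middle vertex [z] that is adjacent to neither [x] nor [y]. *)
Lemma even_half_nbr x y u w : at_dist e 4 x y -> u \notin even_half x y -> e u w ->
  w \in even_half x y.
Proof.
move=> d4; pose A := [pred u | (u \in even_half x y) ||
  [forall w, e u w ==> (w \in even_half x y)]].
suff : A u by case/orP=> [->//|/forallP/(_ w)/implyP].
apply: (connect_closed econ (x := x)); first by rewrite /A /= inE eqxx.
have xside s t a : at_dist e 4 s t -> even_half s t = even_half x y -> e s a -> A a.
  move=> st E sa; apply/orP; right; apply/forallP=> n; apply/implyP=> an.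
  rewrite -E inE; case: eqP => //= /eqP ns.
  by have [-> _] := mid_nbr st sa an ns; rewrite orbT.
have d4' := at_dist_sym eS d4; have E' := esym (even_half_sym d4).
move=> z {}w zw /orP[|/forallP/(_ w)/implyP/(_ zw)]; last by rewrite /A /= => ->.
rewrite inE => /or3P[/eqP zE|/eqP zE|xz].
- by apply: (xside x y _ d4 erefl); rewrite -zE.
- by apply: (xside y x _ d4' E'); rewrite -zE.
case: (boolP (e x w)) => [|nxw]; first exact: (xside x y w d4 erefl).
case: (boolP (e y w)) => [|nyw]; first exact: (xside y x w d4' E').
have [w0 [_ _ _ wP]] := mid_split2 d4 xz.
have w0E : w = w0 by have := wP w zw; rewrite (negPf nxw) (negPf nyw) => /eqP.
(* As [w] is the exceptional neighbour of [z], any other neighbour [c] of [z] is adjacent to [x] or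
   [y], so the fourth corner of a 4-cycle through [w], [z], [c] lies in the middle and [rect_full]
   applies. *)
have X : [set v | e w v && at_dist e 2 x v] = nbrs e w.
  apply: (@rect_full w z); first by rewrite inE eS zw.
    by apply/subsetP=> v; rewrite !inE => /andP[].
  move=> c v zc cw vc wv; rewrite inE wv /=.
  have cv : e c v by rewrite eS.
  have := wP c zc; rewrite -w0E (negPf cw) orbF => /orP[xc|yc].
    have vx : v != x by apply: contraNneq nxw => <-; rewrite eS.
    by have [] := mid_nbr d4 xc cv vx.
  have vy : v != y by apply: contraNneq nyw => <-; rewrite eS.
  by rewrite (mid_at_dist2 _ d4); have [] := mid_nbr d4' yc cv vy.
apply/orP; right; apply/forallP=> v; apply/implyP; rewrite -in_nbrs -X !inE => /andP[_ ->].
by rewrite !orbT.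
Qed.

Lemma even_half_edge x y u w : at_dist e 4 x y -> e u w ->
  (w \in even_half x y) = (u \notin even_half x y).
Proof.
move=> d4 uw; apply/idP/idP=> [hw|hu]; last exact: even_half_nbr hu uw.
by apply/negP=> hu; have := even_half_indep d4 hu hw; rewrite uw.
Qed.

Lemma card_even_half x y : at_dist e 4 x y -> #|even_half x y| = (2 * k).+2.
Proof.
move=> d4; have E : even_half x y = x |: (y |: [set z | at_dist e 2 x z]).
  by apply/setP=> u; rewrite !inE.
rewrite E cardsU1 in_setU1 negb_or cardsU1 card_at_dist2 !inE.
have -> : x != y by apply: contraNneq (at_dist_not (m := 0) d4 isT) => ->; rewrite dist_le0.
by rewrite (mid_at_dist2 y d4) !at_dist2 // !eqxx.
Qed.

Lemma card_odd_half x y : at_dist e 4 x y -> #|~: even_half x y| = (2 * k).+2.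
Proof.
move=> d4; rewrite -(card_even_half d4).
have := sum_card_exchange (even_half x y) (~: even_half x y) e.
rewrite (eq_bigr (fun=> k)); last first.
  move=> u hu; rewrite -(degH u); apply: eq_card => w; rewrite in_set in_setC in_nbrs.
  by case: (boolP (e u w)) => [uw|]; rewrite ?andbF // (even_half_edge d4 uw) hu.
rewrite [RHS](eq_bigr (fun=> k)); last first.
  move=> w; rewrite in_setC => hw; rewrite -(degH w); apply: eq_card => u.
  rewrite in_set in_nbrs eS; case: (boolP (e w u)) => [wu|]; rewrite ?andbF //.
  by rewrite (even_half_edge d4 wu) hw.
by rewrite !sum_nat_const => /eqP; rewrite eqn_pmul2r ?k_gt0 // => /eqP.
Qed.

(** * Antipodes and the six cells *)

Section Antipodes.
Variables (x0 y0 : T).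
Hypothesis d0 : at_dist e 4 x0 y0.

Let col u := u \in even_half x0 y0.

Lemma col_edge u w : e u w -> col w = ~~ col u.
Proof. exact: even_half_edge. Qed.

Lemma col_path u z w : e u z -> e z w -> col w = col u.
Proof. by move=> /col_edge uz /col_edge->; rewrite uz negbK. Qed.

Lemma card_vertices : #|T| = 4 * k + 4.
Proof.
by rewrite -(cardsC (even_half x0 y0)) card_even_half // card_odd_half //; lia.
Qed.

Lemma col_at_dist2 u w : at_dist e 2 u w -> col w = col u.
Proof. by rewrite at_dist2 // => /and3P[_ _ /existsP[z /andP[h1 /(col_path h1)]]]. Qed.

Lemma col_at_dist4 u w : at_dist e 4 u w -> col w = col u.
Proof.
by move=> /at_dist_prev[z /at_dist_prev[v /col_at_dist2<- vz] /(col_path vz)].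
Qed.

(** The colour class of [u] has [2k + 2] vertices, of which [u] and the [2k] at distance 2 are
    removed. *)
Lemma other_unique u : exists u', forall w,
  [&& col w == col u, w != u & ~~ at_dist e 2 u w] = (w == u').
Proof.
have /eqP/cards1P[u' E] :
    #|[set w | [&& col w == col u, w != u & ~~ at_dist e 2 u w]]| = 1.
  have cH : #|[set w | col w == col u]| = (2 * k).+2.
    case: (boolP (col u)) => cu.
      by rewrite -(card_even_half d0); apply: eq_card => w; rewrite in_set eqb_id.
    by rewrite -(card_odd_half d0); apply: eq_card => w; rewrite in_setC in_set eqbF_neg.
  have : #|[set w | col w == col u] :\: (u |: [set w | at_dist e 2 u w])| = 1.
    rewrite cardsD (setIidPr _) ?cH ?cardsU1 ?card_at_dist2 ?inE.
      by rewrite at_dist2 // eqxx /= add1n subSn ?subnn.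
    by apply/subsetP=> w; rewrite !inE => /orP[/eqP->//|/col_at_dist2->].
  by move=> Z; rewrite -[RHS]Z; apply: eq_card => w; rewrite in_setD in_setU1 !in_set negb_or [RHS]andbC.
by exists u' => w; rewrite -[RHS]in_set1 -E in_set.
Qed.

(** The remaining vertex of the colour class cannot be at distance 0, 1, 2 or 3, by colour or by
    choice; a geodesic to it passes a vertex at distance exactly 4. *)
Lemma antipode_exists u : exists u', at_dist e 4 u u'.
Proof.
have [u' uP] := other_unique u; have := uP u'; rewrite eqxx => /and3P[/eqP cu nu n2].
have [n] := at_dist_exists (econ u u').
have [n4|n3] := leqP 4 n.
  by rewrite -(subnKC n4) => /(at_dist_mid (m := 4))[z uz _]; exists z.
case: n n3 => [|[|[|[|//]]]] _.
- by move=> /andP[/= /eqP E]; rewrite E eqxx in nu.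
- by rewrite at_dist1 // => /col_edge; rewrite cu; case: (col u).
- by move=> h; rewrite h in n2.
- by move/at_dist_prev=> [z /col_at_dist2 cz /col_edge]; rewrite cu cz; case: (col u).
Qed.

Lemma antipode_other u w u' : at_dist e 4 u u' ->
  [&& col w == col u, w != u & ~~ at_dist e 2 u w] = (w == u').
Proof.
move=> d4; have [v vP] := other_unique u; rewrite vP; congr (_ == _); apply/esym/eqP.
rewrite -vP (col_at_dist4 d4) eqxx at_distS negb_and.
have nu : u' != u by have := at_dist_not (m := 0) d4 isT; rewrite /= eq_sym.
by rewrite nu (at_dist_not (m := 2) d4 isT).
Qed.

Lemma antipode_unique u v w : at_dist e 4 u v -> at_dist e 4 u w -> v = w.
Proof. by move=> uv /(antipode_other v)/esym; rewrite (antipode_other v uv) eqxx => /eqP. Qed.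

(** A vertex at distance 5 from [u] would be adjacent to some [v] at distance 4, but [geodesic_full]
    brings all neighbours of [v] within distance 3 of [u]. *)
Lemma at_dist_le4 n u w : at_dist e n u w -> n <= 4.
Proof.
rewrite leqNgt => h; apply/negP=> n4.
have [z uz zw] : exists2 z, at_dist e 5 u z & dist_le e (n - 5) z w.
  by apply: at_dist_mid; rewrite subnKC.
have [v uv vz] := at_dist_prev uz.
have := geodesic_full (at_dist_sym eS uv) vz => /(dist_le_sym eS).
by apply/negP; apply: (at_dist_not (m := 3) uz isT).
Qed.

Lemma diameter4 : diameter e 4.
Proof. by split; [exists x0, y0 | move=> *; apply: at_dist_le4; eassumption]. Qed.

Lemma bipartite_col : bipartite e.
Proof. by exists col => u w /col_edge->; case: (col u). Qed.

(* The neighbours of [w'] outside distance 2 from [y] can only be [x]; if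
   there were none, the paths of length 2 from [y] to them would number
   [k * mu] instead of [(k - 1) * mu]. *)
Lemma antipode_edge x y w w' : at_dist e 4 x y -> at_dist e 4 w w' -> e y w -> e x w'.
Proof.
move=> xy ww' yw; apply/negPn/negP=> nxw'.
have yx := at_dist_sym eS xy.
have cw' : col w' = ~~ col y by rewrite (col_at_dist4 ww') (col_edge yw).
have wy : e w y by rewrite eS.
have d2 b : e w' b -> at_dist e 2 y b.
  move=> w'b; have := antipode_other b yx; rewrite (col_edge w'b) cw' negbK eqxx /=.
  have -> : b != y.
    apply: contraNneq (at_dist_not (m := 2) ww' isT) => bE; rewrite bE in w'b.
    by apply: (dist_le_cons wy); apply: dist_le_edge; rewrite eS.
  have -> : b == x = false by apply: contraNF nxw' => /eqP <-; rewrite eS.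
  by move/negbFE.
have := sum_card_exchange (nbrs e w') (nbrs e y :\ w) e.
rewrite (eq_bigr (fun=> mu)); last first.
  move=> b; rewrite in_nbrs => w'b; rewrite -(at_dist2_card (d2 _ w'b)).
  apply: eq_card => c; rewrite !inE -andbA andbC; case: (eqVneq c w) => [->|_]; last first.
    by rewrite andbT.
  rewrite andbF; apply/esym/negbTE; rewrite negb_and; apply/orP; right.
  apply: contra (at_dist_not (m := 2) ww' isT) => bw.
  by apply: (@dist_le_cons _ _ 1 _ b); [rewrite eS | apply: dist_le_edge; rewrite eS].
rewrite [RHS](eq_bigr (fun=> mu)); last first.
  move=> c; rewrite in_setD1 in_nbrs => /andP[cw yc].
  have [wc _] := mid_nbr ww' wy yc cw.
  rewrite (mid_at_dist2 _ ww') in wc; rewrite -(at_dist2_card wc).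
  by apply: eq_card => b; rewrite !inE [e b c]eS.
rewrite !sum_nat_const => /eqP; rewrite eqn_pmul2r ?mu_gt0 // degH.
by rewrite -(degH y) (cardsD1 w (nbrs e y)) in_nbrs yw -{2}[#|_|]add0n eqn_add2r.
Qed.

(** The values follow the indexing of [quot_mat]. Distance does not separate D3 from D3': D3
    consists of the neighbours of the antipode of [x]. The existential keeps the definition free of
    a chosen antipode. *)
Definition cell x u : nat :=
  if u == x then 0 else if e x u then 1 else if dist_le e 2 x u then 2 else
  if dist_le e 3 x u then
    if [exists y, at_dist e 4 x y && e y u] then 3 else 4
  else 5.

Variant cell_spec x y u : nat -> Prop :=
| Cell0 of u = x : cell_spec x y u 0
| Cell1 of e x u : cell_spec x y u 1
| Cell2 of at_dist e 2 x u : cell_spec x y u 2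
| Cell3 of e y u : cell_spec x y u 3
| Cell4 of u \notin even_half x y & ~~ e x u & ~~ e y u : cell_spec x y u 4
| Cell5 of u = y : cell_spec x y u 5.

Lemma cell_edge x u : e x u -> cell x u = 1.
Proof. by move=> xu; rewrite /cell eq_sym (negPf (e_neq eI xu)) xu. Qed.

Lemma cell_at_dist2 x u : at_dist e 2 x u -> cell x u = 2.
Proof.
move=> xu; have /andP[d2 _] := xu; move: xu; rewrite at_dist2 // /cell eq_sym.
by case/and3P=> /negPf-> /negPf-> _; rewrite d2.
Qed.

Lemma cell_far x u : ~~ dist_le e 2 x u ->
  cell x u = if dist_le e 3 x u then
    if [exists y, at_dist e 4 x y && e y u] then 3 else 4 else 5.
Proof.
move=> far; rewrite /cell (negPf far).
have -> : u == x = false by apply: contraNF far => /eqP->; apply: dist_le_refl.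
by have -> : e x u = false by apply: contraNF far => /dist_le_edge; apply: dist_le_leq.
Qed.

Lemma cell_antipode x y : at_dist e 4 x y -> cell x y = 5.
Proof.
move=> xy; rewrite (cell_far (at_dist_not (m := 2) xy isT)).
by rewrite (negPf (at_dist_not (m := 3) xy isT)).
Qed.

Lemma antipode_nbr_far x y u : at_dist e 4 x y -> e y u -> ~~ dist_le e 2 x u.
Proof.
move=> xy yu; apply: contra (at_dist_not (m := 3) xy isT) => xu.
by apply: dist_le_snoc xu _; rewrite eS.
Qed.

Lemma cell_antipode_edge x y u : at_dist e 4 x y -> e y u -> cell x u = 3.
Proof.
move=> xy yu; rewrite (cell_far (antipode_nbr_far xy yu)).
rewrite (dist_le_sym eS (geodesic_full (at_dist_sym eS xy) yu)).
by have -> : [exists y, at_dist e 4 x y && e y u] by apply/existsP; exists y; rewrite xy.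
Qed.

Lemma cellP x y u : at_dist e 4 x y -> cell_spec x y u (cell x u).
Proof.
move=> xy; case: (eqVneq u x) => [->|ux]; first by rewrite /cell eqxx; constructor.
case: (eqVneq u y) => [->|uy]; first by rewrite cell_antipode //; constructor.
case: (boolP (e x u)) => [xu|nxu]; first by rewrite cell_edge //; constructor.
case: (boolP (e y u)) => [yu|nyu].
  by rewrite (cell_antipode_edge xy yu); constructor.
case: (boolP (at_dist e 2 x u)) => [h|n2]; first by rewrite cell_at_dist2 //; constructor.
have far : ~~ dist_le e 2 x u.
  by apply: contra n2 => h; rewrite at_distS h dist_le1 negb_or eq_sym ux.
have [n] := at_dist_exists (econ x u); move=> dn; have n4 := at_dist_le4 dn.
have d3 : dist_le e 3 x u.
  case: (eqVneq n 4) => [nE|nn].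
    by rewrite nE in dn; rewrite (antipode_unique dn xy) eqxx in uy.
  have /andP[h _] := dn; apply: dist_le_leq h; by rewrite -ltnS ltn_neqAle nn.
have nex : [exists y, at_dist e 4 x y && e y u] = false.
  by apply/existsP=> -[z /andP[/(antipode_unique xy)<-]]; rewrite (negPf nyu).
rewrite (cell_far far) d3 nex; constructor; rewrite // inE.
by rewrite (negPf ux) (negPf uy).
Qed.

Lemma cell_lt6 x u : cell x u < 6.
Proof. by rewrite /cell; do ![case: ifP => // _]. Qed.

(** Only the split between 3 and 4 is not visibly symmetric; [antipode_edge] supplies it, with the
    antipodes of [x] and [u]. *)
Lemma cellC x u : cell x u = cell u x.
Proof.
have dC n : dist_le e n x u = dist_le e n u x by apply/idP/idP; apply: dist_le_sym.
rewrite /cell eq_sym eS !dC; case: ifP => // _; case: ifP => // _; case: ifP => // _.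
case: ifP => // _; congr (if _ then _ else _).
have [x' xx'] := antipode_exists x; have [u' uu'] := antipode_exists u.
apply/existsP/existsP=> -[y /andP[xy yu]].
  by exists u'; rewrite uu' eS; apply: antipode_edge xy uu' yu.
by exists x'; rewrite xx' eS; apply: antipode_edge xy xx' yu.
Qed.

Definition cell_nbrs x u j : {set T} := [set z | (cell x z == j) && e u z].

Lemma cell_nbrs_const x u (c : nat) : (forall z, e u z -> cell x z = c) ->
  forall j, #|cell_nbrs x u j| = if j == c then k else 0.
Proof.
move=> h j; case: eqP => [->|/eqP jc].
  rewrite -(degH u); apply: eq_card => z; rewrite !inE andbC.
  by case: (boolP (e u z)) => //= /h->; rewrite eqxx.
apply: eq_card0 => z; rewrite !inE andbC.
by case: (boolP (e u z)) => //= /h->; rewrite eq_sym (negPf jc).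
Qed.

Lemma cell_nbrs_two x u p (c0 c : nat) : e u p -> cell x p = c0 -> c0 != c ->
  (forall z, e u z -> z != p -> cell x z = c) ->
  forall j, #|cell_nbrs x u j| = if j == c0 then 1 else if j == c then k.-1 else 0.
Proof.
move=> up pc c0c h j.
have E z : (z \in cell_nbrs x u j) =
    if z == p then j == c0 else e u z && (j == c).
  rewrite inE andbC; case: (eqVneq z p) => [->|zp]; first by rewrite up pc eq_sym.
  by case: (boolP (e u z)) => //= uz; rewrite h // eq_sym.
case: (eqVneq j c0) => [jc|jc].
  rewrite -(cards1 p); apply: eq_card => z; rewrite E in_set1; case: eqP => //= _.
  + by rewrite jc eqxx.
  + by rewrite jc (negPf c0c) andbF.
case: (eqVneq j c) => [jE|nj].
  have -> : k.-1 = #|nbrs e u :\ p|.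
    by have := cardsD1 p (nbrs e u); rewrite in_nbrs up degH add1n => ->.
  apply: eq_card => z; rewrite E in_setD1 in_nbrs (negPf jc).
  by case: eqP => //= _; rewrite jE eqxx andbT.
by apply: eq_card0 => z; rewrite E (negPf jc) (negPf nj) andbF if_same.
Qed.

Lemma half_k : k.-1./2 = mu.
Proof. by rewrite k_eq /= doubleK. Qed.

Lemma card_cell_nbrs x u (i j : 'I_6) : cell x u = i ->
  #|cell_nbrs x u j| = quot_mat k i j.
Proof.
have [y xy] := antipode_exists x; have yx := at_dist_sym eS xy.
case: (cellP u xy) => [->|xu|xu|yu|uH nxu nyu|->] iE; rewrite /quot_mat /= -iE.
- rewrite (@cell_nbrs_const x x 1) => [|z xz]; last exact: cell_edge.
  by case: j => [[|[|[|[|[|[|]]]]]] //].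
- rewrite (@cell_nbrs_two x u x 0 2) // 1?eS //.
  + by case: j => [[|[|[|[|[|[|]]]]]] //].
  + by rewrite /cell eqxx.
  + by move=> z uz zx; apply: cell_at_dist2; have [] := mid_nbr xy xu uz zx.
(* The [mu], [mu] and 1 neighbours of the split are those in D1, D3 and D3'; the exceptional [w] is
   the one in D3'. *)
- have [w [uw nxw nyw wP]] := mid_split2 xy xu.
  have yu : at_dist e 2 y u by rewrite -(mid_at_dist2 _ xy).
  have cw : cell x w = 4.
    have wH : w \notin even_half x y.
      by rewrite (even_half_edge xy uw) negbK inE xu !orbT.
    case: (cellP w xy) => //.
    + by move=> wx; rewrite wx inE eqxx in wH.
    + by rewrite (negPf nxw).
    + by move=> h; rewrite inE h !orbT in wH.
    + by rewrite (negPf nyw).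
    + by move=> wx; rewrite wx inE eqxx orbT in wH.
  have E (c : nat) : #|cell_nbrs x u c| =
      #|[set z | e u z && (if e x z then c == 1 else if e y z then c == 3 else c == 4)]|.
    apply: eq_card => z; rewrite !inE andbC; case: (boolP (e u z)) => //= uz.
    case: (boolP (e x z)) => [xz|nxz]; first by rewrite cell_edge // eq_sym.
    case: (boolP (e y z)) => [yz|nyz]; first by rewrite (cell_antipode_edge xy yz) eq_sym.
    by have := wP z uz; rewrite (negPf nxz) (negPf nyz) => /eqP ->; rewrite cw eq_sym.
  rewrite E //; case: j => [[|[|[|[|[|[|]]]]]] //] hj /=; rewrite ?half_k.
  + by apply: eq_card0 => z; rewrite !inE !if_same andbF.
  + rewrite -(at_dist2_card xu); apply: eq_card => z; rewrite !inE.
    by case: (e x z); rewrite ?if_same ?andbF ?andbT.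
  + by apply: eq_card0 => z; rewrite !inE !if_same andbF.
  + rewrite -(at_dist2_card yu); apply: eq_card => z; rewrite !inE.
    case: (boolP (e x z)) => xz; last by case: (e y z); rewrite ?andbF ?andbT.
    rewrite andbF; apply/esym/negbTE; rewrite negb_and; apply/orP; left.
    apply: contra (at_dist_not (m := 2) xy isT) => yz.
    by apply: (dist_le_cons xz); apply: dist_le_edge; rewrite eS.
  + rewrite -[RHS](cards1 w); apply: eq_card => z; rewrite !inE.
    case: (eqVneq z w) => [->|zw]; first by rewrite uw (negPf nxw) (negPf nyw).
    apply/negbTE; rewrite negb_and; case: (boolP (e u z)) => //= uz.
    by have := wP z uz; rewrite (negPf zw) orbF; case: (e x z) => //= ->.
  + by apply: eq_card0 => z; rewrite !inE !if_same andbF.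
- rewrite (@cell_nbrs_two x u y 5 2) // 1?eS //.
  + by case: j => [[|[|[|[|[|[|]]]]]] //].
  + exact: cell_antipode.
  + move=> z uz zy; apply: cell_at_dist2; rewrite (mid_at_dist2 _ xy).
    by have [] := mid_nbr yx yu uz zy.
- rewrite (@cell_nbrs_const x u 2) => [|z uz].
    by case: j => [[|[|[|[|[|[|]]]]]] //].
  apply: cell_at_dist2; have := even_half_nbr xy uH uz; rewrite inE.
  case: eqP => [zx|_]; first by rewrite zx eS (negPf nxu) in uz.
  by case: eqP => [zy|_ //]; rewrite zy eS (negPf nyu) in uz.
- rewrite (@cell_nbrs_const x y 3) => [|z yz]; last exact: cell_antipode_edge xy yz.
  by case: j => [[|[|[|[|[|[|]]]]]] //].
Qed.

Lemma card_cell x (i : 'I_6) : #|[set u | cell x u == i]| = cell_size k i.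
Proof.
have [y xy] := antipode_exists x.
pose K j := #|[set u | cell x u == j]|.
have K0 : K 0 = 1.
  rewrite -[RHS](cards1 x); apply: eq_card => u; rewrite !inE /cell.
  by case: (u == x) => //; do ![case: ifP => // _].
have K1 : K 1 = k.
  rewrite -(degH x); apply: eq_card => u; rewrite !inE; apply/eqP/idP; last exact: cell_edge.
  by case: (cellP u xy).
have K2 : K 2 = 2 * k.
  rewrite -(card_at_dist2 x); apply: eq_card => u; rewrite !inE.
  by apply/eqP/idP; [case: (cellP u xy) | exact: cell_at_dist2].
have K3 : K 3 = k.
  rewrite -(degH y); apply: eq_card => u; rewrite !inE.
  by apply/eqP/idP; [case: (cellP u xy) | exact: cell_antipode_edge].
have K5 : K 5 = 1.
  rewrite -[RHS](cards1 y); apply: eq_card => u; rewrite !inE.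
  by apply/eqP/eqP=> [|->]; [case: (cellP u xy) | exact: cell_antipode].
have sumK : \sum_(j < 6) K j = 4 * k + 4.
  rewrite -card_vertices -sum1_card (partition_big (fun u => Ordinal (cell_lt6 x u)) predT) //=.
  by apply: eq_bigr => j _; rewrite /K -sum1_card; apply: eq_bigl => u; rewrite inE -val_eqE.
move: sumK; rewrite !big_ord_recl big_ord0 /= /bump /= !add1n K0 K1 K2 K3 K5 => sumK.
(* D3' is what the other five cells leave of the [4k + 4] vertices. *)
have K4 : K 4 = 2 by lia.
by case: i => [[|[|[|[|[|[|]]]]]] //] hi; rewrite /cell_size /= -?K0 -?K1 -?K2 -?K3 -?K4 -?K5.
Qed.

End Antipodes.
End GeodesicallyClosed.


(** * The association scheme and its eigenvalues *)

Import Order.TTheory GRing.Theory Num.Theory.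

Lemma ord6_ind (P : 'I_6 -> Prop) :
  P (inord 0) -> P (inord 1) -> P (inord 2) -> P (inord 3) -> P (inord 4) ->
  P (inord 5) -> forall i, P i.
Proof.
move=> h0 h1 h2 h3 h4 h5 i; rewrite -[i]inord_val.
by case: i => [[|[|[|[|[|[|]]]]]] //].
Qed.

Lemma sum_ord6 (V : nmodType) (F : 'I_6 -> V) : (\sum_j F j =
  F (inord 0) + F (inord 1) + F (inord 2) + F (inord 3) + F (inord 4) + F (inord 5))%R.
Proof.
rewrite !big_ord_recl big_ord0 addr0 !addrA.
by do !congr (_ + _)%R; congr F; apply: val_inj; rewrite /= inordK.
Qed.

Lemma inord6_eq i j : (i < 6)%N -> (j < 6)%N -> (inord i == inord j :> 'I_6) = (i == j).
Proof. by move=> hi hj; rewrite -val_eqE /= !inordK. Qed.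

Section Scheme.
Local Open Scope ring_scope.
Variables (T : finType) (e : rel T) (k mu : nat) (c : T -> T -> 'I_6).
Hypotheses (eS : symmetric e) (mu_gt0 : (0 < mu)%N) (k_eq : k = mu.*2.+1).
Hypothesis c0 : forall x y, (c x y == inord 0) = (x == y).
Hypothesis c1 : forall x y, (c x y == inord 1) = e x y.
Hypothesis c2 : forall x y, at_dist e 2 x y -> c x y = inord 2.
Hypothesis cC : forall x y, c x y = c y x.
Hypothesis c_nbrs : forall x y (j : 'I_6),
  #|[set z | (c x z == j) && e y z]| = quot_mat k (c x y) j.

Lemma sum_quot_row (F : pzRingType) (p : 'I_6 -> F) (i : 'I_6) :
  \sum_j p j * (quot_mat k i j)%:R = nth 0
    [:: p (inord 1) * k%:R;
        p (inord 0) + p (inord 2) * k.-1%:R;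
        p (inord 1) * mu%:R + p (inord 3) * mu%:R + p (inord 4);
        p (inord 2) * k.-1%:R + p (inord 5);
        p (inord 2) * k%:R;
        p (inord 3) * k%:R] i.
Proof.
have mE : k.-1./2 = mu by rewrite k_eq /= doubleK.
rewrite sum_ord6; case: i => [[|[|[|[|[|[|]]]]]] //] hi;
  by rewrite /quot_mat /= !inordK //= ?mE ?mulr0 ?mulr1 ?addr0 ?add0r.
Qed.

Lemma sum_quot_col (F : pzRingType) (p : 'I_6 -> F) (j : 'I_6) :
  \sum_i p i * (quot_mat k i j)%:R = nth 0
    [:: p (inord 1);
        p (inord 0) * k%:R + p (inord 2) * mu%:R;
        p (inord 1) * k.-1%:R + p (inord 3) * k.-1%:R + p (inord 4) * k%:R;
        p (inord 2) * mu%:R + p (inord 5) * k%:R;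
        p (inord 2);
        p (inord 3)] j.
Proof.
have mE : k.-1./2 = mu by rewrite k_eq /= doubleK.
rewrite sum_ord6; case: j => [[|[|[|[|[|[|]]]]]] //] hj;
  by rewrite /quot_mat /= !inordK //= ?mE ?mulr0 ?mulr1 ?addr0 ?add0r.
Qed.

(** On functions constant on the classes, multiplication by the adjacency matrix acts as the
    quotient matrix. *)
Lemma sum_cell_nbrs (F : pzRingType) (p : 'I_6 -> F) x y :
  \sum_z p (c x z) * (e z y)%:R = \sum_j p j * (quot_mat k (c x y) j)%:R.
Proof.
rewrite (partition_big (c x) predT) //=; apply: eq_bigr => j _.
rewrite (eq_bigr (fun z => p j * (e z y)%:R)); last by move=> z /eqP->.
rewrite -big_distrr /= -c_nbrs -sum1_card natr_sum; congr (_ * _).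
rewrite big_mkcond [RHS]big_mkcond /=; apply: eq_bigr => z _; rewrite inE (eS z).
by case: (c x z == j); case: (e y z).
Qed.

(** * Closure of the span of the classes under products *)

Definition comp (f g : T -> T -> rat) x y := \sum_z f x z * g z y.

Definition in_span (f : T -> T -> rat) := exists p : 'I_6 -> rat, forall x y, f x y = p (c x y).

(** Right multiplication by the matrix of [p] maps the span of the classes into itself. Such [p] are
    closed under linear combinations and under multiplication by the adjacency matrix, so they
    include all its polynomials. *)
Definition preserves (p : 'I_6 -> rat) :=
  forall f, in_span f -> in_span (comp f (fun x y => p (c x y))).

Lemma preserves_lin (a b : rat) p q r : preserves p -> preserves q ->
  (forall i, r i = a * p i + b * q i) -> preserves r.
Proof.
move=> hp hq rE f hf; have [p' pE] := hp f hf; have [q' qE] := hq f hf.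
exists (fun i => a * p' i + b * q' i) => x y; rewrite -pE -qE /comp !big_distrr /= -big_split.
by apply: eq_bigr => z _; rewrite rE /=; ring.
Qed.

Lemma preserves_quot p r : preserves p ->
  (forall i, r i = \sum_j p j * (quot_mat k i j)%:R) -> preserves r.
Proof.
move=> hp rE f hf; have [p' pE] := hp f hf.
exists (fun i => \sum_j p' j * (quot_mat k i j)%:R) => x y; rewrite -sum_cell_nbrs.
rewrite (eq_bigr (fun z => \sum_w f x w * p (c w z) * (e z y)%:R)); last first.
  by move=> z _; rewrite -pE big_distrl.
rewrite exchange_big; apply: eq_bigr => w _; rewrite rE -sum_cell_nbrs big_distrr /=.
by apply: eq_bigr => z _; rewrite mulrA.
Qed.

Let delta (j i : 'I_6) : rat := (i == j)%:R.

(** Each class is reached as a polynomial in A = F_1: A^2 = k I + mu F_2; A F_2 minus (k-1) A is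
    [v], that is (k-1) F_3 + k F_4; A times [v] is ((k-1) mu + k) F_2 + k (k-1) F_5; A F_5 = F_3;
    and [v] then yields F_4. The coefficients below solve these equations. *)
Lemma preserves_delta j : preserves (delta j).
Proof.
have kq : k%:R = mu%:R * 2 + 1 :> rat by rewrite k_eq -addn1 -muln2 natrD natrM.
have kq1 : k.-1%:R = mu%:R * 2 :> rat by rewrite k_eq -muln2 natrM.
have m0 : mu%:R != 0 :> rat by rewrite pnatr_eq0 -lt0n.
have k0 : mu%:R * 2 + 1 != 0 :> rat by rewrite -kq k_eq pnatr_eq0.
have unit_h f : f =2 (fun x y => delta (inord 0) (c x y)) ->
    forall g x y, comp g f x y = g x y.
  move=> fE g x y; rewrite /comp (bigD1 y) //= fE /delta c0 eqxx mulr1 big1 ?addr0 // => z zy.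
  by rewrite fE /delta c0 (negPf zy) mulr0.
have h0 : preserves (delta (inord 0)).
  by move=> f [p pE]; exists p => x y; rewrite unit_h.
have h1 : preserves (delta (inord 1)).
  apply: (preserves_quot h0) => i; rewrite sum_quot_row /delta.
  by elim/ord6_ind: i; rewrite !inord6_eq //= inordK //= ?kq ?kq1; ring.
pose w2 i := \sum_j delta (inord 1) j * (quot_mat k i j)%:R.
have hw2 : preserves w2 by apply: (preserves_quot h1).
have h2 : preserves (delta (inord 2)).
  apply: (preserves_lin (a := mu%:R^-1) (b := - k%:R / mu%:R) hw2 h0) => i.
  rewrite /w2 sum_quot_row /delta.
  by elim/ord6_ind: i; rewrite !inord6_eq //= inordK //= ?kq ?kq1; field.
pose w3 i := \sum_j delta (inord 2) j * (quot_mat k i j)%:R.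
have hw3 : preserves w3 by apply: (preserves_quot h2).
pose v i := w3 i - k.-1%:R * delta (inord 1) i.
have hv : preserves v.
  by apply: (preserves_lin (a := 1) (b := - k.-1%:R) hw3 h1) => i; rewrite /v; ring.
pose w4 i := \sum_j v j * (quot_mat k i j)%:R.
have hw4 : preserves w4 by apply: (preserves_quot hv).
have h5 : preserves (delta (inord 5)).
  apply: (preserves_lin (a := (k%:R * k.-1%:R)^-1)
    (b := - (k.-1%:R * mu%:R + k%:R) / (k%:R * k.-1%:R)) hw4 h2) => i.
  rewrite /w4 sum_quot_row /v /w3 !sum_quot_row /delta.
  elim/ord6_ind: i; rewrite !inord6_eq //= !inordK //= ?kq ?kq1; field; by rewrite m0 k0.
have h3 : preserves (delta (inord 3)).
  apply: (preserves_quot h5) => i; rewrite sum_quot_row /delta.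
  by elim/ord6_ind: i; rewrite !inord6_eq //= inordK //= ?kq ?kq1; ring.
have h4 : preserves (delta (inord 4)).
  apply: (preserves_lin (a := k%:R^-1) (b := - k.-1%:R / k%:R) hv h3) => i.
  rewrite /v /w3 sum_quot_row /delta.
  by elim/ord6_ind: i; rewrite !inord6_eq //= inordK //= ?kq ?kq1; field.
by elim/ord6_ind: j.
Qed.

Lemma cell_scheme : assoc_scheme (fun i x y => c x y == i).
Proof.
split=> [x y|x y|i x y|i j].
- by rewrite -c0; congr (_ == _); apply: val_inj; rewrite /= inordK.
- rewrite (bigD1 (c x y)) //= eqxx big1 // => i; rewrite eq_sym; by case: eqP.
- by rewrite cC.
- have [|p pE] := @preserves_delta j (fun x y => delta i (c x y)).
    by exists (delta i).
  exists p => x y; rewrite [LHS]pE (bigD1 (c x y)) //= eqxx mulr1 big1 ?addr0 // => h.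
  by rewrite eq_sym => /negPf->; rewrite mulr0.
Qed.

Lemma walks_cell n : exists g : 'I_6 -> nat, forall x y, walks e n x y = g (c x y).
Proof.
elim: n => [|n [g gE]]; first by exists (fun i => i == inord 0) => x y; rewrite /= c0.
exists (fun i => \sum_(j < 6) g j * quot_mat k i j)%N => x y /=.
rewrite (partition_big (c x) predT) //=; apply: eq_bigr => j _; rewrite -c_nbrs.
rewrite (eq_bigr (fun z => g j * e z y)%N); last by move=> z /eqP<-; rewrite gE.
rewrite -big_distrr /= -sum1_card; congr (_ * _)%N.
rewrite big_mkcond [RHS]big_mkcond /=; apply: eq_bigr => z _; rewrite inE (eS z).
by case: (c x z == j); case: (e y z).
Qed.

(** Distances 0, 1 and 2 each determine the class, and the class determines the number of walks. *)
Lemma cell_walk_regular : walk_regular e 2.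
Proof.
move=> m n x y x' y' m2 d d'; have [g gE] := walks_cell n; rewrite !gE; congr g.
case: m m2 d d' => [|[|[|//]]] _.
- by move=> /andP[/= xy _] /andP[/= xy' _]; rewrite -c0 in xy; rewrite -c0 in xy';
    rewrite (eqP xy) (eqP xy').
- have E u w : at_dist e 1 u w -> c u w = inord 1.
    rewrite /at_dist dist_le1 /= => /andP[/orP[/eqP->|]]; first by rewrite eqxx.
    by rewrite -c1 => /eqP.
  by move=> /E-> /E->.
- by move=> /c2-> /c2->.
Qed.

(** * Eigenvalues *)

Lemma eigenvalue_adjmx (a : algC) : eigenvalue (adjmx e) a <->
  exists w : T -> algC, (exists x, w x != 0) /\
    forall y, \sum_z w z * (e z y)%:R = a * w y.
Proof.
split=> [/eigenvalueP[v vE v0]|[w [[x wx] wE]]].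
  exists (fun y => v ord0 (enum_rank y)); split.
    have [i vi] : exists i, v ord0 i != 0.
      apply/existsP; apply: contraR v0; rewrite negb_exists => /forallP h.
      by apply/eqP/rowP=> i; rewrite mxE; apply/eqP; have := h i; rewrite negbK.
    by exists (enum_val i); rewrite enum_valK.
  move=> y; have /rowP/(_ (enum_rank y)) := vE; rewrite !mxE => <-.
  rewrite (reindex (@enum_val T predT)); last first.
    by exists enum_rank => i _; [rewrite enum_valK | rewrite enum_rankK].
  by apply: eq_bigr => i _; rewrite enum_valK mxE enum_rankK.
apply/eigenvalueP; exists (\row_i w (enum_val i)).
  apply/rowP=> j; rewrite !mxE -wE (reindex (@enum_val T predT)); last first.
    by exists enum_rank => i _; [rewrite enum_valK | rewrite enum_rankK].
  by apply: eq_bigr => i _; rewrite !mxE.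
by apply: contraNneq wx => /rowP/(_ (enum_rank x)); rewrite !mxE enum_rankK => ->.
Qed.

(** A right eigenvector [g] of the quotient matrix, spread over the cells around [x], is an
    eigenvector of the graph; it is nonzero at [x] because its entry 0 is. *)
Lemma quot_eigenvalue (x : T) (a : algC) (g : seq algC) :
  g`_0 != 0 -> [/\ g`_1 * k%:R = a * g`_0, g`_0 + g`_2 * k.-1%:R = a * g`_1,
    g`_1 * mu%:R + g`_3 * mu%:R + g`_4 = a * g`_2 &
    [/\ g`_2 * k.-1%:R + g`_5 = a * g`_3, g`_2 * k%:R = a * g`_4 & g`_3 * k%:R = a * g`_5]] ->
  eigenvalue (adjmx e) a.
Proof.
move=> g0 [r0 r1 r2 [r3 r4 r5]]; apply/eigenvalue_adjmx.
exists (fun y => g`_(c x y)); split.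
  exists x; have /eqP-> : c x x == inord 0 by rewrite c0.
  by rewrite inordK.
move=> y; rewrite (sum_cell_nbrs (fun i : 'I_6 => g`_i)) sum_quot_row !inordK //.
by elim/ord6_ind: (c x y); rewrite inordK.
Qed.

(* The cell sums [s j] of an eigenvector around a vertex [x] form a left
   eigenvector of the quotient matrix, with [s 0] its value at [x]. *)
Lemma eigenvalue_cases (a : algC) : eigenvalue (adjmx e) a ->
  [|| a == k%:R, a == - k%:R, a ^+ 2 == k%:R, a == 1 | a == -1].
Proof.
case/eigenvalue_adjmx=> w [[x wx] wE].
have kq : k%:R = mu%:R * 2 + 1 :> algC by rewrite k_eq -addn1 -muln2 natrD natrM.
have kq1 : k.-1%:R = mu%:R * 2 :> algC by rewrite k_eq -muln2 natrM.
pose s j := \sum_y (c x y == j)%:R * w y.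
have sE j : a * s j = \sum_i s i * (quot_mat k i j)%:R.
  have -> : \sum_i s i * (quot_mat k i j)%:R = \sum_z w z * (quot_mat k (c x z) j)%:R.
    rewrite (eq_bigr (fun i => \sum_z (c x z == i)%:R * w z * (quot_mat k i j)%:R)); last first.
      by move=> i _; rewrite big_distrl.
    rewrite exchange_big; apply: eq_bigr => z _.
    rewrite (bigD1 (c x z)) //= eqxx mul1r big1 ?addr0 // => i.
    by rewrite eq_sym => /negPf->; rewrite !mul0r.
  rewrite /s big_distrr /=.
  rewrite (eq_bigr (fun y => \sum_z (c x y == j)%:R * (w z * (e z y)%:R))); last first.
    by move=> y _; rewrite mulrCA -wE big_distrr.
  rewrite exchange_big; apply: eq_bigr => z _.
  rewrite -c_nbrs -sum1_card natr_sum big_distrr /= [RHS]big_mkcond.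
  apply: eq_bigr => y _; rewrite inE.
  by case: (c x y == j); case: (e z y); rewrite /= ?mulr0 ?mul0r ?mulr1 ?mul1r.
have s0 : s (inord 0) = w x.
  rewrite /s (bigD1 x) //= c0 eqxx mul1r big1 ?addr0 // => y yx.
  by rewrite c0 eq_sym (negPf yx) mul0r.
have E0 := sE (inord 0); have E1 := sE (inord 1); have E2 := sE (inord 2).
have E3 := sE (inord 3); have E4 := sE (inord 4); have E5 := sE (inord 5).
rewrite !sum_quot_col !inordK //= ?kq1 ?kq in E0 E1 E2 E3 E4 E5.
rewrite s0 in E0 E1; rewrite kq.
set t := w x in wx E0 E1; set m : algC := mu%:R in E1 E2 E3 *.
move: (s (inord 1)) (s (inord 2)) (s (inord 3)) (s (inord 4)) (s (inord 5)) E0 E1 E2 E3 E4 E5.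
move=> s1 s2 s3 s4 s5 E0 E1 E2 E3 E4 E5.
case: (eqVneq (a ^+ 2) (m * 2 + 1)) => [|na]; first by rewrite !orbT.
(* Both [t] and [s5] solve (a^2 - k) X = mu s2, by the equations of columns 0, 1 and of columns 5,
   3. *)
have s5E : s5 = t.
  apply: (mulfI (x := a ^+ 2 - (m * 2 + 1))); first by rewrite subr_eq0.
  apply/eqP; rewrite -subr_eq0; apply/eqP.
  have -> : (a ^+ 2 - (m * 2 + 1)) * s5 - (a ^+ 2 - (m * 2 + 1)) * t =
    (a * (a * s5) - s5 * (m * 2 + 1)) - (a * (a * t) - t * (m * 2 + 1)) by ring.
  by rewrite E5 E0 E3 E1; ring.
(* Eliminating [s2] gives (a^2 - k)^2 = (k-1)^2 a^2 after division by [t], and a^2 - k = (k-1) a or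
   -(k-1) a has the roots k, -1 or -k, 1. *)
have E6 : (a ^+ 2 - (m * 2 + 1)) ^+ 2 * t - (m * 2) ^+ 2 * a ^+ 2 * t = 0.
  have h1 : (a ^+ 2 - (m * 2 + 1)) * t = s2 * m.
    have -> : (a ^+ 2 - (m * 2 + 1)) * t = a * (a * t) - t * (m * 2 + 1) by ring.
    by rewrite E0 E1; ring.
  have h2 : (a ^+ 2 - (m * 2 + 1)) * s2 = 2 * (m * 2) * a ^+ 2 * t.
    have -> : (a ^+ 2 - (m * 2 + 1)) * s2 = a * (a * s2) - (m * 2 + 1) * s2 by ring.
    rewrite E2 -[s3]E5 -[s1]E0 s5E -[X in _ - _ * X]E4; ring.
  rewrite expr2 -mulrA h1.
  have -> : (a ^+ 2 - (m * 2 + 1)) * (s2 * m) = (a ^+ 2 - (m * 2 + 1)) * s2 * m by ring.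
  by rewrite h2; ring.
have : (a - (m * 2 + 1)) * (a + 1) * ((a + (m * 2 + 1)) * (a - 1)) * t = 0.
  by rewrite -E6; ring.
move/eqP; rewrite !mulf_eq0 (negPf wx) orbF !subr_eq0 !addr_eq0.
by case/orP=> /orP[]->; rewrite ?orbT.
Qed.

Lemma cell_num_eigenvalues (x : T) : num_eigenvalues e 6.
Proof.
have kq : k%:R = mu%:R * 2 + 1 :> algC by rewrite k_eq -addn1 -muln2 natrD natrM.
have kq1 : k.-1%:R = mu%:R * 2 :> algC by rewrite k_eq -muln2 natrM.
have k_gt1 : (1 < k)%N by rewrite k_eq; lia.
set r := sqrtC (k%:R : algC).
have r2 : r ^+ 2 = k%:R by rewrite sqrtCK.
have k_gt0 : 0 < k%:R :> algC by rewrite ltr0n ltnW.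
have r_gt0 : 0 < r by rewrite sqrtC_gt0.
have r_gt1 : 1 < r by rewrite -[ltLHS]sqrtC1 ltr_sqrtC ?nnegrE ?ler01 ?ler0n ?ltr1n.
have r_ltk : r < k%:R by rewrite -r2 expr2 ltr_pMr.
have r_ltk' := lt_trans r_gt1 r_ltk.
exists [:: k%:R; - k%:R; r; - r; 1; -1]; split=> // [|a].
  have neqN (u v : algC) : 0 < u -> 0 < v -> (u == - v) = false.
    by move=> hu hv; rewrite gt_eqF // (lt_trans _ hu) // oppr_lt0.
  have neqN' (u v : algC) : 0 < u -> 0 < v -> (- u == v) = false.
    by move=> hu hv; rewrite eq_sym neqN.
  by rewrite /= !inE !eqr_opp !neqN ?neqN' ?ltr01 // !(gt_eqF r_ltk, gt_eqF r_gt1, gt_eqF r_ltk').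
split.
  move/eigenvalue_cases; rewrite !inE -r2 eqf_sqr.
  by case/or4P=> [->|->|/orP[]->|/orP[]->]; rewrite ?orbT.
have k0 : k%:R != 0 :> algC by rewrite gt_eqF.
(* The witnesses are right eigenvectors of the quotient matrix. In each pair for a and -a, the
   second is the first with signs changed on the odd cells 1, 3 and 4. *)
rewrite !inE => /or4P[/eqP->|/eqP->|/eqP->|/or3P[]/eqP->].
- apply: (@quot_eigenvalue x _ [:: 1; 1; 1; 1; 1; 1]); rewrite ?oner_eq0 //=.
  by split; [..|split]; rewrite ?kq ?kq1; ring.
- apply: (@quot_eigenvalue x _ [:: 1; -1; 1; -1; -1; 1]); rewrite ?oner_eq0 //=.
  by split; [..|split]; rewrite ?kq ?kq1; ring.
- apply: (@quot_eigenvalue x _ [:: k%:R; r; 0; - r; 0; - k%:R]); rewrite //=.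
  by split; [..|split]; rewrite -?r2; ring.
- apply: (@quot_eigenvalue x _ [:: k%:R; - r; 0; r; 0; - k%:R]); rewrite //=.
  by split; [..|split]; rewrite -?r2; ring.
- apply: (@quot_eigenvalue x _ [:: k%:R; 1; -1; 1; - k%:R; k%:R]); rewrite //=.
  by split; [..|split]; rewrite ?kq ?kq1; ring.
- apply: (@quot_eigenvalue x _ [:: k%:R; -1; -1; -1; k%:R; k%:R]); rewrite //=.
  by split; [..|split]; rewrite ?kq ?kq1; ring.
Qed.

End Scheme.

Theorem theorem1p5 (T : finType) (e : rel T) (v k lam mu d : nat) :
  simple_graph e -> connected_graph e -> diameter e d -> 4 <= d ->
  amply_regular e v k lam mu ->
  odd k -> 5 <= k -> 2 * mu = k.-1 ->
  [\/ graph_iso e cube5,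
      graph_iso e (K2_box delta41) |
      exists R : 'I_6 -> rel T,
        [/\ assoc_scheme R,
            forall x y, e x y = R (inord 1) x y,
            forall x (i : 'I_6), #|[set y | R i x y]| = cell_size k i,
            forall x (i j : 'I_6) y, R i x y ->
              #|[set z | R j x z && e y z]| = quot_mat k i j &
            [/\ bipartite e, walk_regular e 2, #|T| = 4 * k + 4,
                diameter e 4 & num_eigenvalues e 6]]].
Proof.
move=> [eS eI] econ [[x [y' dxy']] _] d4 [_ degH lamH muH] k_odd k5 muE.
have mu_gt1 : 1 < mu by lia.
have k_eq : k = mu.*2.+1 by lia.
(* The diameter may exceed 4 a priori, so a longest geodesic is cut at distance 4. *)
have [y dxy _] : exists2 y, at_dist e 4 x y & dist_le e (d - 4) y y'.
  by apply: at_dist_mid; rewrite subnKC.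
have [z xz zy] := at_dist_mid (m := 2) (n := 2) dxy.
have {}xz : dist_le e 2 x z by case/andP: xz.
have far : ~~ dist_le e 3 x y by case/andP: dxy.
have lam_le := lam_le_mu eS eI degH lamH muH mu_gt1 k_eq far xz zy.
have lam0 := lam_eq0 eS degH lamH muH mu_gt1 k_eq lam_le dxy xz zy.
have tri := triangle_free lamH lam0.
have cross := card_common_nbrs eS lamH muH lam0.
have [||closed] : [\/ graph_iso e cube5, graph_iso e (K2_box delta41) | geodesic_closed e].
- case: (ltngtP mu 2) => [mu_lt|mu_gt|mu2]; first by rewrite ltnNge mu_gt1 in mu_lt.
    by constructor 3; exact: geodesic_closed_of_mu3 eS degH lamH muH mu_gt1 k_eq lam_le lam0 mu_gt.
  rewrite mu2 in cross; rewrite k_eq mu2 in degH.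
  exact: valency5_cases eS eI degH tri cross x econ.
- by constructor 1.
- by constructor 2.
constructor 3.
have lt6 u w : cell e u w < 6 by apply: cell_lt6.
(* The default value of [inord] never occurs, since cells are below 6. *)
pose c u w : 'I_6 := inord (cell e u w).
have cE u w (i : 'I_6) : (c u w == i) = (cell e u w == i) by rewrite -val_eqE /= inordK.
have c0 u w : (c u w == inord 0) = (u == w).
  rewrite cE inordK // /cell [u == w]eq_sym; case: (w == u) => //.
  by do ![case: ifP => // _].
have c1 u w : (c u w == inord 1) = e u w.
  rewrite cE inordK // /cell; case: (eqVneq w u) => [->|_]; first by rewrite eI.
  by do ![case: ifP => // _].
have c2 u w : at_dist e 2 u w -> c u w = inord 2 by move=> h; rewrite /c cell_at_dist2.
have cC u w : c u w = c w u.
  by rewrite /c (cellC eS eI degH tri cross mu_gt1 k_eq econ closed dxy u w).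
have c_nbrs u w (j : 'I_6) : #|[set t | (c u t == j) && e w t]| = quot_mat k (c u w) j.
  rewrite -(card_cell_nbrs eS eI degH tri cross mu_gt1 k_eq econ closed dxy (u := w) (x := u)).
    by apply: eq_card => t; rewrite !inE cE.
  by rewrite inordK.
have mu_gt0 := ltnW mu_gt1.
exists (fun i u w => c u w == i); split=> //.
- exact (cell_scheme eS mu_gt0 k_eq c0 cC c_nbrs).
- move=> u i; rewrite -(card_cell eS eI degH tri cross mu_gt1 k_eq econ closed dxy u).
  by apply: eq_card => w; rewrite !inE cE.
- by move=> u i j w /eqP <-.
- split.
  + exact (bipartite_col eS eI degH tri cross mu_gt1 k_eq econ closed dxy).
  + exact (cell_walk_regular eS c0 c1 c2 c_nbrs).
  + exact (card_vertices eS eI degH tri cross mu_gt1 k_eq econ closed dxy).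
  + exact (diameter4 eS degH cross mu_gt1 closed dxy).
  + exact (cell_num_eigenvalues eS mu_gt0 k_eq c0 c_nbrs x).
Qed.
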